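(* Let $G_{1,1}$ be the group with presentation $\langle a,b,c,d,s,t \mid c=ab=ba,\ d=ab^{-1},\ s^{-1}as=c,\ t^{-1}at=d\rangle$ and let $X=\{a^{\pm1},b^{\pm1},c^{\pm1},d^{\pm1},s^{\pm1},t^{\pm1}\}$. Then $(G_{1,1},X)$ is almost convex.
   Context: $\Gamma(G,X)$ denotes the Cayley graph of $G$ with respect to $X$, with each edge of length 1 and the path metric. $(G,X)$ is almost convex if there is a constant $C$ such that for every integer $N\ge0$, every pair of points of $\Gamma(G,X)$ at distance at most 2 from each other and each within distance $N$ of the identity is joined by a path of length at most $C$ which lies within distance $N$ of the identity. *)

(* Defs.v *)
From HB Require Import structures.
From mathcomp Require Import all_boot all_order all_algebra.
From mathcomp Require Import boolp classical_sets reals constructive_ereal ereal.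

Set Implicit Arguments.
Unset Strict Implicit.
Unset Printing Implicit Defensive.

Import Order.TTheory GRing.Theory Num.Theory.

Local Open Scope classical_set_scope.
Local Open Scope group_scope.
Local Open Scope quotient_scope.

(* The letter (x, false) stands for x and (x, true) for x^-1. *)
Notation word S := (seq (S * bool)).

Definition inv_word (S : Type) (w : word S) : word S :=
  [seq (l.1, ~~ l.2) | l <- rev w].

(* The least congruence on the free monoid on S and the formal inverses of S
   that contains the free cancellations and the relations [rels]. *)
Inductive word_eq (S : eqType) (rels : seq (word S * word S)) :
    word S -> word S -> Prop :=
| word_eq_refl u : word_eq rels u u
| word_eq_sym u v : word_eq rels u v -> word_eq rels v u
| word_eq_trans u v w :
    word_eq rels u v -> word_eq rels v w -> word_eq rels u w
| word_eq_cat u u' v v' :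
    word_eq rels u u' -> word_eq rels v v' -> word_eq rels (u ++ v) (u' ++ v')
| word_eq_cancel x e : word_eq rels [:: (x, e); (x, ~~ e)] [::]
| word_eq_rel u v : (u, v) \in rels -> word_eq rels u v.

Lemma word_eq_inv (S : eqType) (rels : seq (word S * word S)) (u v : word S) :
  word_eq rels u v -> word_eq rels (inv_word u) (inv_word v).
Proof.
have invl w : word_eq rels (inv_word w ++ w) [::].
  elim: w => [|[x e] w IHw]; first exact: word_eq_refl.
  rewrite /inv_word rev_cons map_rcons -/(inv_word w) cat_rcons /=.
  apply: word_eq_trans IHw.
  apply: word_eq_cat; first exact: word_eq_refl.
  rewrite -[w in X in word_eq _ _ X]cat0s -cat1s -[_ :: w]cat1s catA.
  apply: word_eq_cat; last exact: word_eq_refl.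
  by have := word_eq_cancel rels x (~~ e); rewrite negbK.
have invr w : word_eq rels (w ++ inv_word w) [::].
  have := invl (inv_word w); rewrite {1}/inv_word /inv_word -map_rev revK.
  by rewrite mapK // => -[x e] /=; rewrite negbK.
move=> uv.
have h1 : word_eq rels (inv_word u) (inv_word u ++ (v ++ inv_word v)).
  rewrite -[X in word_eq _ X _]cats0; apply: word_eq_cat.
    exact: word_eq_refl.
  exact/word_eq_sym/invr.
apply: word_eq_trans h1 _; rewrite catA -[X in word_eq _ _ X]cat0s.
apply: word_eq_cat; last exact: word_eq_refl.
apply: word_eq_trans (invl u); apply: word_eq_cat; first exact: word_eq_refl.
exact: word_eq_sym.
Qed.

Definition word_eqb (S : eqType) (rels : seq (word S * word S)) : rel (word S) :=
  fun u v => `[< word_eq rels u v >].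

Section Presented.
Context (S : choiceType) (rels : seq (word S * word S)).

Let word_eqb_refl : reflexive (word_eqb rels).
Proof. by move=> u; apply/asboolP/word_eq_refl. Qed.

Let word_eqb_sym : symmetric (word_eqb rels).
Proof. by move=> u v; apply/asboolP/asboolP => /word_eq_sym. Qed.

Let word_eqb_trans : transitive (word_eqb rels).
Proof.
by move=> v u w /asboolP uv /asboolP vw; apply/asboolP/(word_eq_trans uv vw).
Qed.

Canonical word_equiv :=
  EquivRel (word_eqb rels) word_eqb_refl word_eqb_sym word_eqb_trans.

(* The group with presentation < S | rels >. *)
Definition presented : Type := {eq_quot word_equiv}.

HB.instance Definition _ := Choice.on presented.
HB.instance Definition _ := Quotient.on presented.

Definition presented_class (w : word S) : presented := \pi_presented w.

Definition presented_mul (g h : presented) : presented :=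
  presented_class (repr g ++ repr h).

Definition presented_inv (g : presented) : presented :=
  presented_class (inv_word (repr g)).

Lemma presented_classP (u v : word S) :
  presented_class u = presented_class v <-> word_eq rels u v.
Proof.
rewrite /presented_class; split => [/eqmodP/asboolP //|uv].
exact/eqmodP/asboolP.
Qed.

Lemma presented_classK (g : presented) : presented_class (repr g) = g.
Proof. exact: reprK. Qed.

Lemma repr_presented_class (w : word S) :
  word_eq rels (repr (presented_class w)) w.
Proof. by apply/presented_classP; rewrite presented_classK. Qed.

Lemma presented_class_cat (u v : word S) :
  presented_class (u ++ v) =
  presented_mul (presented_class u) (presented_class v).
Proof.
apply/presented_classP/word_eq_sym.
by apply: word_eq_cat; apply: repr_presented_class.
Qed.

Lemma presented_class_inv (w : word S) :
  presented_class (inv_word w) = presented_inv (presented_class w).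
Proof. exact/presented_classP/word_eq_sym/word_eq_inv/repr_presented_class. Qed.

Let mulA : associative presented_mul.
Proof.
move=> g h k; rewrite -[g]presented_classK -[h]presented_classK.
by rewrite -[k]presented_classK -!presented_class_cat catA.
Qed.

Let mul1 : left_id (presented_class [::]) presented_mul.
Proof. by move=> g; rewrite -[g]presented_classK -presented_class_cat. Qed.

Let mul1r : right_id (presented_class [::]) presented_mul.
Proof. by move=> g; rewrite -[g]presented_classK -presented_class_cat cats0. Qed.

Let mulV : left_inverse (presented_class [::]) presented_inv presented_mul.
Proof.
move=> g; rewrite -[g]presented_classK -presented_class_inv -presented_class_cat.
apply/presented_classP; elim: (repr g) => [|[x e] w IHw].
  exact: word_eq_refl.
rewrite /inv_word rev_cons map_rcons -/(inv_word w) cat_rcons /=.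
apply: word_eq_trans IHw; apply: word_eq_cat; first exact: word_eq_refl.
apply: (@word_eq_cat _ _ [:: (x, ~~ e); (x, e)] [::]).
  by have := word_eq_cancel rels x (~~ e); rewrite negbK.
exact: word_eq_refl.
Qed.

Let mulVr : right_inverse (presented_class [::]) presented_inv presented_mul.
Proof.
move=> g; rewrite -[LHS]mul1 -[X in presented_mul X _](mulV (presented_inv g)).
by rewrite -mulA [X in presented_mul _ X]mulA mulV mul1 mulV.
Qed.

HB.instance Definition _ :=
  isGroup.Build presented mulA mul1 mul1r mulV mulVr.

End Presented.

(* The element of < S | rels > represented by the generator x. *)
Definition presented_gen (S : choiceType) (rels : seq (word S * word S)) (x : S) :
  presented rels := presented_class rels [:: (x, false)].

Section CayleyGraph.
Context (R : realType) (G : groupType) (X : set G).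

Local Open Scope ring_scope.

(* g and h are joined by a single edge, whichever direction it is read in. *)
Definition cayley_adj (g h : G) : Prop :=
  X (g^-1 * h)%g \/ X (h^-1 * g)%g.

(* Points of the geometric realization are given by their barycentric
   coordinates, G -> R: [cayley_pt g h t] is the point (1 - t) g + t h, at
   distance t from g along the edge {g, h}.  This does the identifications:
   [cayley_pt g h t = cayley_pt h g (1 - t)] and [cayley_pt g h 0] is the
   vertex g.  It is meant for 1 \notin X, so that the graph has no loops. *)
Definition cayley_pt (g h : G) (t : R) : G -> R :=
  fun v => (1 - t) * (v == g)%:R + t * (v == h)%:R.

Definition cayley_vertex (g : G) : G -> R := fun v => (v == g)%:R.

Definition cayley_point (p : G -> R) : Prop :=
  (exists g, p = cayley_vertex g) \/
  (exists g h t, [/\ cayley_adj g h, 0 <= t <= 1 & p = cayley_pt g h t]).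

(* [cayley_path B p q l]: a piecewise linear path of length l from p to q all of
   whose points are in B, that is, a concatenation of finitely many segments
   [(1 - s) g + s h, (1 - t) g + t h], each contained in one edge {g, h}. *)
Inductive cayley_path (B : set (G -> R)) : (G -> R) -> (G -> R) -> R -> Prop :=
| cayley_path_nil p : B p -> cayley_path B p p 0
| cayley_path_cons g h s t q l :
    cayley_adj g h -> 0 <= s <= 1 -> 0 <= t <= 1 ->
    (forall r, Num.min s t <= r <= Num.max s t -> B (cayley_pt g h r)) ->
    cayley_path B (cayley_pt g h t) q l ->
    cayley_path B (cayley_pt g h s) q (`|s - t| + l).

(* The path metric (+oo between distinct components). *)
Definition cayley_dist (p q : G -> R) : \bar R :=
  ereal_inf [set l%:E | l in [set l | cayley_path setT p q l]].

Definition cayley_ball (N : nat) : set (G -> R) :=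
  [set p | (cayley_dist (cayley_vertex 1%g) p <= N%:R%:E)%E].

Definition almost_convex : Prop :=
  exists C : R, forall (N : nat) (p q : G -> R),
    cayley_point p -> cayley_point q ->
    (cayley_dist p q <= 2%:E)%E -> cayley_ball N p -> cayley_ball N q ->
    exists2 l, l <= C & cayley_path (cayley_ball N) p q l.

End CayleyGraph.

Arguments almost_convex R {G} X.

Variant gen11 : Type := Ga | Gb | Gc | Gd | Gs | Gt.

Definition gen11_code (x : gen11) : nat :=
  match x with Ga => 0 | Gb => 1 | Gc => 2 | Gd => 3 | Gs => 4 | Gt => 5 end.

Definition gen11_decode (n : nat) : option gen11 :=
  nth None [seq Some x | x <- [:: Ga; Gb; Gc; Gd; Gs; Gt]] n.

Lemma gen11_codeK : pcancel gen11_code gen11_decode.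
Proof. by case. Qed.

HB.instance Definition _ := Countable.copy gen11 (pcan_type gen11_codeK).

Definition pos (x : gen11) : gen11 * bool := (x, false).
Definition neg (x : gen11) : gen11 * bool := (x, true).

Definition rels11 : seq (word gen11 * word gen11) :=
  [:: ([:: pos Gc], [:: pos Ga; pos Gb]);
      ([:: pos Gc], [:: pos Gb; pos Ga]);
      ([:: pos Gd], [:: pos Ga; neg Gb]);
      ([:: neg Gs; pos Ga; pos Gs], [:: pos Gc]);
      ([:: neg Gt; pos Ga; pos Gt], [:: pos Gd]) ].

Definition G11 : groupType := presented rels11.

Definition X11 : set G11 :=
  [set g : G11 | exists x : gen11,
    g = presented_gen rels11 x \/ g = (presented_gen rels11 x)^-1].

(* Main.v *)
Require Import Defs.
From mathcomp Require Import reals.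
From Stdlib Require Import ZArith Lia.
From mathcomp Require Import all_boot all_order all_algebra.
From mathcomp Require Import boolp classical_sets constructive_ereal ereal lra.

(** The group is a multiple HNN extension of the lattice generated by [a] and
[b], with stable letters conjugating [a] to [c = ab] and [a] to [d = a b^-1].
On the lattice the generators [a, b, c, d] give the king metric
[max(|x|, |y|)], for which the three cyclic subgroups [<a>], [<c>] and [<d>]
are isometrically embedded; hence the stable letters act by isometries and the
word length can be computed coset by coset.  An element is written
[b^rn en ... b^r1 e1 a^x b^y] with stable letters [ei]; the pairs [(ri, ei)]
form a stack which names a coset of the lattice, and right multiplication by a
generator either moves [(x, y)] by a king move or pushes or pops the stack
([act]).  The word length [level st x y] on a coset is the minimum over [k] of
[1 + f k] plus the king distance from [(x, y)] to the [k]-th point of the line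
through which the coset is entered, [f] being the word length in the preceding
coset along the matching line ([len_act], [descend]).

Balls are almost convex provided that such a function has no two separate
valleys along a lattice line of direction [a], [c] or [d], for otherwise nearby
points of one coset would be joined in the ball only through a long detour.
The word length is not convex on these lines: passing from a diagonal line to a
horizontal one halves the argument and rounds, and a naive unimodality is lost
by the next passage, which doubles it.  What survives is convexity up to 1 at
every dyadic scale: for each [n = 2^k], the increment [f (i + n) - f i] never
drops by more than 1 as [i] grows.  The case [n = 1] is unimodality
([nearly_convex_between]), and the whole family is inherited from a coset to the
next one ([conv_nearly_convex]) by an exchange argument: two optimal points [k1]
and [k2] of the entry line are either swapped or replaced by [k1 + n] and
[k2 - n] ([conv_exchange]).  As moreover the length does not increase when one
moves vertically towards the entry line ([conv_towards]), two points of one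
coset in the ball of radius [N] are joined there by a path of length at most
three times their distance: vertically to a common parallel of the entry line,
then along it ([vpath_coset]).

For two elements joined by [n] letters, excursions into further cosets can be
cut off, so that one reaches a common coset from both of them by lattice moves
and pops only ([valley_word]).  A point of the ball that is near its entry line
is also near an optimal point of this line, which is reached inside the ball;
so each pop can be performed there at the cost of a bounded displacement
([downward_vpath]), and [vpath_coset] finishes in the common coset
([vpath_word]).

It remains to pass from vertices to points of the graph.  An edge is contained
in the ball of radius [N] as soon as one of its endpoints has length less than
[N].  Two points at distance at most 2 have endpoints at distance at most 2;
from these one steps to vertices of length less than [N], which are joined by
the path above with all its vertices of length less than [N]. *)

Set Implicit Arguments.
Unset Strict Implicit.

(** * Functions of one variable that are convex up to rounding *)

Local Open Scope Z_scope.

(** The line through the origin of slope 0, 1 or -1 is the subgroup generated by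
[a], [c] or [d] in the lattice. *)
Definition slope (e : Z) := e = 0 \/ e = 1 \/ e = -1.
Definition king (x y : Z) := Z.max (Z.abs x) (Z.abs y).
Definition lip (f : Z -> Z) := forall i j, f i <= f j + Z.abs (i - j).
(** Increments over steps of length [n] are nondecreasing up to an error of 1. *)
Definition convex_upto1 (n : Z) (f : Z -> Z) :=
  forall i j, i <= j -> f (i + n) + f j <= f (j + n) + f i + 1.

Fixpoint min_upto (f : Z -> Z) (lo : Z) (n : nat) : Z :=
  if n is S m then Z.min (f (lo + Z.of_nat n)) (min_upto f lo m) else f lo.

Lemma min_uptoP f lo n :
  (forall k, lo <= k <= lo + Z.of_nat n -> min_upto f lo n <= f k) /\
  (exists2 k, lo <= k <= lo + Z.of_nat n & min_upto f lo n = f k).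
Proof.
elim: n => [|n [IHle [k0 k0P IHk]]].
  split=> [k k_in|]; last by exists lo => //; lia.
  have -> : k = lo by lia.
  exact: Z.le_refl.
have -> : min_upto f lo n.+1 =
  Z.min (f (lo + Z.of_nat n.+1)) (min_upto f lo n) by [].
split=> [k k_in|].
  have [->|k_neq] := Z.eq_dec k (lo + Z.of_nat n.+1); first by lia.
  have := IHle k; lia.
have [le_f|lt_f] := Z_le_gt_dec (f (lo + Z.of_nat n.+1)) (min_upto f lo n).
  by exists (lo + Z.of_nat n.+1); lia.
by exists k0; lia.
Qed.

(** The king distance from [(x, y)] to the [k]-th point of the line of slope [e]. *)
Definition cost (e x y k : Z) : Z := king (x - k) (y - e * k).

(** The infimal convolution of a function on the line of slope [e] with the king
norm.  For a 1-Lipschitz function the points [k] of this window suffice. *)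
Definition conv (e : Z) (f : Z -> Z) (x y : Z) : Z :=
  let r := Z.abs (y - e * x) in
  min_upto (fun k => f k + cost e x y k) (x - r) (Z.to_nat (2 * r)).

Lemma conv_le_near e f x y k : Z.abs (x - k) <= Z.abs (y - e * x) ->
  conv e f x y <= f k + cost e x y k.
Proof.
move=> k_near.
by apply: (proj1 (min_uptoP (fun k => f k + cost e x y k) _ _)); lia.
Qed.

Lemma conv_le e f x y k : slope e -> lip f ->
  conv e f x y <= f k + cost e x y k.
Proof.
move=> sle lipf.
pose r := Z.abs (y - e * x); pose k' := Z.max (x - r) (Z.min (x + r) k).
have := @conv_le_near e f x y k'; have := lipf k' k.
rewrite {}/k' {}/r /cost /king; case: sle => [|[]] ->; lia.
Qed.

(** Points of the line of slope [e] that are closest to [(x, y)]: for the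
horizontal line all those within [|y|] of [x], for a diagonal line the one or
two points nearest to the midpoint. *)
Definition centred (e x y k : Z) : Prop :=
  (e = 0 -> Z.abs (x - k) <= Z.abs y) /\
  (e <> 0 -> Z.abs (2 * k - (x + e * y)) <= 1).

(** As the function is 1-Lipschitz, moving an optimal point to the nearest centred
one loses nothing: every step towards it saves 1 in distance. *)
Lemma conv_attained e f x y : slope e -> lip f ->
  exists2 k, conv e f x y = f k + cost e x y k & centred e x y k.
Proof.
move=> sle lipf.
have [k Ek] : exists k, conv e f x y = f k + cost e x y k.
  have [_ [k _ Ek]] := min_uptoP (fun k => f k + cost e x y k)
    (x - Z.abs (y - e * x)) (Z.to_nat (2 * Z.abs (y - e * x))).
  by exists k.
have [e0|e_neq0] := Z.eq_dec e 0.
  (* k' is the point of the centred window that is nearest to k *)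
  pose k' := Z.max (x - Z.abs y) (Z.min (x + Z.abs y) k).
  exists k'; last by split; lia.
  have := @conv_le e f x y k' sle lipf; have := lipf k' k.
  by rewrite {}/k'; move: Ek; rewrite e0 /cost /king; lia.
have [h hP] : exists h, 2 * h <= x + e * y <= 2 * h + 1.
  exists ((x + e * y) / 2); have := Z.div_mod (x + e * y) 2.
  by have := Z.mod_pos_bound (x + e * y) 2; lia.
pose k' := Z.max h (Z.min (x + e * y - h) k).
exists k'; last by split; rewrite {}/k'; lia.
have := @conv_le e f x y k' sle lipf; have := lipf k' k.
rewrite {}/k'; move: hP Ek; rewrite /cost /king.
by case: sle => [//|[]] ->; lia.
Qed.

Lemma conv_lip e f x y x' y' : slope e -> lip f ->
  conv e f x y <= conv e f x' y' + king (x - x') (y - y').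
Proof.
move=> sle lipf; have [k -> _] := conv_attained x' y' sle lipf.
have := @conv_le e f x y k sle lipf; rewrite /cost /king; lia.
Qed.

Lemma conv_step_y e f x y d : slope e -> lip f ->
  (d = 1 \/ d = -1) -> d * (y - e * x) < 0 -> conv e f x (y + d) <= conv e f x y.
Proof.
move=> sle lipf dP dneg; have [k -> kP] := conv_attained x y sle lipf.
have := @conv_le e f x (y + d) k sle lipf.
have := @conv_le e f x (y + d) (k - 1) sle lipf.
have := @conv_le e f x (y + d) (k + 1) sle lipf.
have := lipf (k - 1) k; have := lipf (k + 1) k.
move: kP dneg; rewrite /cost /king /centred.
case: sle => [|[]] ->; case: dP => ->; lia.
Qed.

Lemma conv_step_x e f x y d : e = 1 \/ e = -1 -> lip f ->
  (d = 1 \/ d = -1) -> d * (x - e * y) < 0 -> conv e f (x + d) y <= conv e f x y.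
Proof.
move=> e1 lipf dP dneg; have sle : slope e by right.
have [k -> kP] := conv_attained x y sle lipf.
have := @conv_le e f (x + d) y k sle lipf.
have := @conv_le e f (x + d) y (k - 1) sle lipf.
have := @conv_le e f (x + d) y (k + 1) sle lipf.
have := lipf (k - 1) k; have := lipf (k + 1) k.
move: kP dneg; rewrite /cost /king /centred.
case: e1 => ->; case: dP => ->; lia.
Qed.

(** The invariant of the word length along lattice lines.  For a coset entered
through a horizontal line, scale [l] on a diagonal requires scale [2 * l] on the
entry line; for a coset entered through a diagonal, scale [l] on the entry line
yields scale [2 * l] on horizontal lines.  So the scales have to be closed under
doubling. *)
Record nearly_convex (f : Z -> Z) : Prop := NearlyConvex {
  nearly_convex_ge0 : forall k, 0 <= f k;
  nearly_convex_lip : lip f;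
  nearly_convex_scale : forall k : nat, convex_upto1 (2 ^ Z.of_nat k) f }.
Arguments nearly_convex_ge0 {f} _ k.
Arguments nearly_convex_scale {f} _ k [i j] _.

(** Optimal points [k1] for the first point and [k2] for the second one serve the
third and the fourth, either swapped or after exchanging [n] units; the second
option is paid by the near convexity of [f].  This reduces each convexity
property of a convolution to an inequality between king distances. *)
Lemma conv_exchange e f n x1 y1 x2 y2 x3 y3 x4 y4 :
  slope e -> lip f -> convex_upto1 n f ->
  (forall k1 k2, centred e x1 y1 k1 -> centred e x2 y2 k2 ->
     cost e x3 y3 k2 + cost e x4 y4 k1 <= cost e x1 y1 k1 + cost e x2 y2 k2 + 1
     \/ k1 <= k2 - n /\
        cost e x3 y3 (k1 + n) + cost e x4 y4 (k2 - n)
          <= cost e x1 y1 k1 + cost e x2 y2 k2) ->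
  conv e f x3 y3 + conv e f x4 y4 <= conv e f x2 y2 + conv e f x1 y1 + 1.
Proof.
move=> sle lipf cvxf H.
have [k1 E1 C1] := conv_attained x1 y1 sle lipf.
have [k2 -> /(H _ _ C1){}H] := conv_attained x2 y2 sle lipf.
rewrite {}E1.
have le_conv x y k : conv e f x y <= f k + cost e x y k by exact: conv_le.
case: H => [?|[/cvxf]]; first by have := le_conv x3 y3 k2; have := le_conv x4 y4 k1; lia.
rewrite Z.sub_add.
by have := le_conv x3 y3 (k1 + n); have := le_conv x4 y4 (k2 - n); lia.
Qed.

Lemma cost_shift e x y k d : cost e (x + d) (y + e * d) (k + d) = cost e x y k.
Proof. by rewrite /cost; congr king; lia. Qed.

Lemma centred_closest e x y k : slope e -> centred e x y k ->
  forall k', cost e x y k <= cost e x y k'.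
Proof. move=> + + k'; by rewrite /cost /king /centred; case=> [|[]] ->; lia. Qed.

(** Both points [k1 + l] and [k2 - l] are translates along the line.  If
they are out of order, the windows of centred points overlap and the optimal
points can be swapped. *)
Lemma conv_convex_along e f x y l : slope e -> lip f -> 0 < l ->
  convex_upto1 l f -> convex_upto1 l (fun k => conv e f (x + k) (y + e * k)).
Proof.
move=> sle lipf l0 Kf i j ij; apply: (conv_exchange sle lipf Kf) => ki kj Ci Cj.
have Ei : cost e (x + (i + l)) (y + e * (i + l)) (ki + l) =
          cost e (x + i) (y + e * i) ki.
  by rewrite -[RHS](cost_shift _ _ _ _ l); congr cost; lia.
have Ej : cost e (x + j) (y + e * j) (kj - l) =
          cost e (x + (j + l)) (y + e * (j + l)) kj.
  by rewrite -[LHS](cost_shift _ _ _ _ l); congr cost; lia.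
have [le|gt] := Z_le_gt_dec ki (kj - l); first by right; lia.
left; rewrite -Ei -Ej.
suff [Ci' Cj'] : centred e (x + (i + l)) (y + e * (i + l)) kj /\
                 centred e (x + j) (y + e * j) ki.
  have := @centred_closest _ _ _ _ sle Ci' (ki + l).
  by have := @centred_closest _ _ _ _ sle Cj' (kj - l); lia.
move: Ci Cj; rewrite /centred; clear Ei Ej Kf lipf.
case: sle => [|[]] -> [C0 C1] [C0' C1'].
- by have := C0 erefl; have := C0' erefl; split; split; lia.
- by have := C1 ltac:(lia); have := C1' ltac:(lia); split; split; lia.
- by have := C1 ltac:(lia); have := C1' ltac:(lia); split; split; lia.
Qed.

Lemma conv0_opp f x y : lip f -> conv 0 f x (- y) = conv 0 f x y.
Proof.
have s0 : slope 0 by left.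
move=> lipf; have le_opp z : conv 0 f x (- z) <= conv 0 f x z.
  have [k -> _] := conv_attained x z s0 lipf.
  have := @conv_le 0 f x (- z) k s0 lipf; rewrite /cost /king; lia.
have := le_opp y; have := le_opp (- y); rewrite Z.opp_involutive; lia.
Qed.

(** On a diagonal line the window of centred points of the horizontal axis grows
by 2 at one end per unit step, whence the exchange of [2 * l] units.  The
inequality has no uniform proof: it depends on which of the four points lie
above the axis. *)
Lemma exchange_diag x y i j l k1 k2 : i <= j -> 0 < l ->
  Z.abs (x + i - k1) <= Z.abs (y + i) ->
  Z.abs (x + (j + l) - k2) <= Z.abs (y + (j + l)) ->
  king (x + (i + l) - k2) (y + (i + l)) + king (x + j - k1) (y + j)
    <= Z.abs (y + i) + Z.abs (y + (j + l)) \/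
  k1 <= k2 - 2 * l /\
  king (x + (i + l) - (k1 + 2 * l)) (y + (i + l)) +
  king (x + j - (k2 - 2 * l)) (y + j)
    <= Z.abs (y + i) + Z.abs (y + (j + l)).
Proof.
move=> ij l0 /Z.abs_le C1 /Z.abs_le C2.
(* the shift is used exactly when the swap fails *)
set A := king _ _ + king _ _ <= _.
have [?|nA] : A \/ ~ A by rewrite /A; lia.
  by left.
right; move: nA C1 C2; rewrite {}/A /king.
case: (Z.abs_spec (y + i)) => [[? ->]|[? ->]];
case: (Z.abs_spec (y + (j + l))) => [[? ->]|[? ->]]; try (exfalso; lia);
case: (Z.abs_spec (y + j)) => [[? ->]|[? ->]]; try (exfalso; lia);
case: (Z.abs_spec (y + (i + l))) => [[? ->]|[? ->]]; try (exfalso; lia);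
by move=> nA C1 C2; split; lia.
Qed.

Lemma conv0_convex_diag f x y l : lip f -> 0 < l -> convex_upto1 (2 * l) f ->
  convex_upto1 l (fun k => conv 0 f (x + k) (y + k)).
Proof.
move=> lipf l0 Kf i j ij; have s0 : slope 0 by left.
apply: (conv_exchange s0 lipf Kf) => k1 k2 [/(_ erefl) C1 _] [/(_ erefl) C2 _].
rewrite /cost !Z.sub_0_r.
have -> : king (x + i - k1) (y + i) = Z.abs (y + i) by rewrite /king; lia.
have -> : king (x + (j + l) - k2) (y + (j + l)) = Z.abs (y + (j + l)).
  by rewrite /king; lia.
by have [?|?] := exchange_diag ij l0 C1 C2; [left; lia|right].
Qed.

(** The distance to a diagonal is half the distance along a lattice axis, rounded
up. *)
Lemma centred_cost e x y k : e = 1 \/ e = -1 -> centred e x y k ->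
  Z.abs (x - e * y) <= 2 * cost e x y k <= Z.abs (x - e * y) + 1.
Proof.
move=> e1 [_ Ck]; have {}Ck := Ck ltac:(lia).
by move: Ck; rewrite /cost /king; case: e1 => ->; split; lia.
Qed.

(** On a line perpendicular to the diagonal the centred points are constant, so
only the convexity of the distance to the diagonal matters. *)
Lemma conv_convex_across e f x y l : e = 1 \/ e = -1 -> lip f -> 0 < l ->
  convex_upto1 l (fun k => conv e f (x + k) (y - e * k)).
Proof.
move=> e1 lipf l0 i j ij; have sle : slope e by right.
(* the optimal points are swapped in all cases: the exchange is by 0 units *)
have K0 : convex_upto1 0 f by move=> p q _; rewrite !Z.add_0_r; lia.
apply: (conv_exchange sle lipf K0) => k1 k2 C1 C2; left.
have same u v k : centred e (x + u) (y - e * u) k ->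
    centred e (x + v) (y - e * v) k.
  by rewrite /centred; case: e1 => ->; lia.
have := centred_cost e1 C1; have := centred_cost e1 C2.
have := centred_cost e1 (same _ (i + l) _ C2).
have := centred_cost e1 (same _ j _ C1).
by case: e1 => ->; lia.
Qed.

(** Moving 2 units along the horizontal line moves the centred points by one unit,
so scale [l] for [f] gives scale [2 * l]; at even scales the roundings of the
distances cancel. *)
Lemma conv_convex_side e f x y l : e = 1 \/ e = -1 -> lip f -> 0 < l ->
  convex_upto1 l f -> convex_upto1 (2 * l) (fun k => conv e f (x + k) y).
Proof.
move=> e1 lipf l0 Kf i j ij; have sle : slope e by right.
have [->|neq] := Z.eq_dec i j; first lia.
apply: (conv_exchange sle lipf Kf) => k1 k2 C1 C2; right.
have C3 : centred e (x + (i + 2 * l)) y (k1 + l) by move: C1; rewrite /centred; lia.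
have C4 : centred e (x + j) y (k2 - l) by move: C2; rewrite /centred; lia.
split; first by move: C1 C2; rewrite /centred; case: e1 => ->; lia.
have := centred_cost e1 C1; have := centred_cost e1 C2.
have := centred_cost e1 C3; have := centred_cost e1 C4.
by move: ij l0; clear; lia.
Qed.

(** Scale 1 holds for every 1-Lipschitz [f]: no value increases on the way to the
diagonal, and none decreases after it. *)
Lemma conv_convex_side1 e f x y : e = 1 \/ e = -1 -> lip f ->
  convex_upto1 1 (fun k => conv e f (x + k) y).
Proof.
move=> e1 lipf i j ij; have sle : slope e by right.
have [->|neq] := Z.eq_dec i j; first lia.
have up k : e * y <= x + k -> conv e f (x + k) y <= conv e f (x + (k + 1)) y.
  move=> ky; have := @conv_step_x e f (x + (k + 1)) y (-1) e1 lipf.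
  by rewrite -Z.add_assoc -Z.add_assoc [1 + -1]/= Z.add_0_r; lia.
have dn k : x + k < e * y -> conv e f (x + (k + 1)) y <= conv e f (x + k) y.
  move=> ky; have := @conv_step_x e f (x + k) y 1 e1 lipf.
  by rewrite -Z.add_assoc; lia.
have lipc k k' := @conv_lip e f (x + k) y (x + k') y sle lipf.
have := up i; have := up j; have := dn i; have := dn j.
have := lipc (i + 1) i; have := lipc j (j + 1).
by rewrite /king; lia.
Qed.

(** The inductive step of the whole proof: near convexity along the entry line of
a coset gives near convexity along all lattice lines of that coset. *)
Lemma conv_nearly_convex e h f x y : slope e -> slope h -> nearly_convex f ->
  nearly_convex (fun k => conv e f (x + k) (y + h * k)).
Proof.
move=> sle slh [f0 lipf cvxf]; split=> [k|i j|k].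
- have [p -> _] := conv_attained (x + k) (y + h * k) sle lipf.
  by have := f0 p; rewrite /cost /king; lia.
- have := @conv_lip e f (x + i) (y + h * i) (x + j) (y + h * j) sle lipf.
  by rewrite /king; case: slh => [|[]] ->; lia.
set l := 2 ^ Z.of_nat k.
have l0 : 0 < l by apply: Z.pow_pos_nonneg; lia.
have cvx2 : convex_upto1 (2 * l) f.
  by have := cvxf k.+1; rewrite Nat2Z.inj_succ Z.pow_succ_r //; lia.
have ext g : (forall k, conv e f (x + k) (y + h * k) = g k) ->
    convex_upto1 l g -> convex_upto1 l (fun k => conv e f (x + k) (y + h * k)).
  by move=> Eg cvxg i j /cvxg; rewrite !Eg.
have [->|eNh] := Z.eq_dec h e; first exact: (conv_convex_along sle lipf l0 (cvxf k)).
case: (sle) => [e0|e1].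
  case: slh => [h0|[h1|h1]]; first lia.
    apply: (ext (fun k => conv 0 f (x + k) (y + k))); last exact: conv0_convex_diag.
    by move=> p; rewrite e0; congr conv; lia.
  apply: (ext (fun k => conv 0 f (x + k) (- y + k))); last exact: conv0_convex_diag.
  by move=> p; rewrite -conv0_opp // e0; congr conv; lia.
have [h0|hN0] := Z.eq_dec h 0; last first.
  apply: (ext (fun k => conv e f (x + k) (y - e * k))); last exact: conv_convex_across.
  by move=> p; congr conv; case: slh => [|[]]; lia.
apply: (ext (fun k => conv e f (x + k) y)).
  by move=> p; congr conv; lia.
case: k @l l0 cvx2 ext => [|k] l l0 _ _; first exact: conv_convex_side1.
rewrite /l Nat2Z.inj_succ Z.pow_succ_r; last by lia.
apply: conv_convex_side (cvxf k) => //; apply: Z.pow_pos_nonneg; lia.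
Qed.

Set Strict Implicit.

(** A value above both ends requires an increment 1 followed later by an increment
-1, which scale 1 excludes. *)
Lemma nearly_convex_between f i k j : nearly_convex f -> i <= k <= j -> f k <= Z.max (f i) (f j).
Proof.
move=> gf [ik kj].
have rise n : f (k - Z.of_nat n) < f k -> exists2 p, p < k & f p < f (p + 1).
  elim: n => [|n IHn]; first by rewrite Z.sub_0_r; lia.
  have [lt_f _|le_f lt_f] := Z_lt_le_dec (f (k - Z.of_nat n.+1)) (f (k - Z.of_nat n)).
    exists (k - Z.of_nat n.+1); first by lia.
    by have -> : k - Z.of_nat n.+1 + 1 = k - Z.of_nat n by lia.
  by apply: IHn; lia.
have fall n : f (k + Z.of_nat n) < f k -> exists2 q, k <= q & f (q + 1) < f q.
  elim: n => [|n IHn]; first by rewrite Z.add_0_r; lia.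
  have [lt_f _|le_f lt_f] := Z_lt_le_dec (f (k + Z.of_nat n.+1)) (f (k + Z.of_nat n)).
    exists (k + Z.of_nat n); first by lia.
    by have -> : k + Z.of_nat n + 1 = k + Z.of_nat n.+1 by lia.
  by apply: IHn; lia.
have [//|gt_f] := Z_le_gt_dec (f k) (Z.max (f i) (f j)).
have [|p pk fp] := rise (Z.to_nat (k - i)).
  have -> : k - Z.of_nat (Z.to_nat (k - i)) = i by lia.
  by lia.
have [|q kq fq] := fall (Z.to_nat (j - k)).
  have -> : k + Z.of_nat (Z.to_nat (j - k)) = j by lia.
  by lia.
have pq : p <= q by lia.
by have := nearly_convex_scale gf 0 pq; rewrite /=; lia.
Qed.

(** * Normal forms and the word length *)

(** The first component tells [s] (true) from [t], the second one marks inverses. *)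
Definition stable : Type := (bool * bool)%type.
Definition sgn (b : bool) : Z := if b then 1 else -1.
(** [slope_in e] and [slope_out e] are the slopes of the subgroups [P] and [Q] of
the lattice for which [P e = e Q]. *)
Definition slope_in (e : stable) : Z := if e.2 then sgn e.1 else 0.
Definition slope_out (e : stable) : Z := if e.2 then 0 else sgn e.1.
Definition opp (e : stable) : stable := (e.1, ~~ e.2).

(** The state [State [:: (r1, e1); ...; (rn, en)] x y] is the element
[b^rn en ... b^r1 e1 a^x b^y].  Powers of [b] represent the cosets in the lattice
of each of the three lines, the coordinate [x] giving the position on the line. *)
Record state := State { stack : seq (Z * stable); px : Z; py : Z }.
Definition origin := State [::] 0 0.

Definition shift (dx dy : Z) (g : state) : state :=
  State (stack g) (px g + dx) (py g + dy).

Definition cancels (r : Z) (e : stable) (st : seq (Z * stable)) : bool :=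
  if st is (_, e') :: _ then (e' == opp e) && Z.eqb r 0 else false.

Definition cross (e : stable) (g : state) : state :=
  let: State st x y := g in
  let r := y - slope_in e * x in
  match st with
  | (r', e') :: st' =>
      if cancels r e st then State st' x (r' + slope_in e' * x)
      else State ((r, e) :: st) x (slope_out e * x)
  | [::] => State [:: (r, e)] x (slope_out e * x)
  end.

(** No pinch: a stack is reduced when no stable letter meets its inverse with a
trivial power of [b] in between. *)
Fixpoint reduced_stack (st : seq (Z * stable)) : bool :=
  if st is (r, e) :: st' then ~~ cancels r e st' && reduced_stack st' else true.
Definition reduced (g : state) : bool := reduced_stack (stack g).

Definition act (g : state) (l : gen11 * bool) : state :=
  let s := if l.2 then -1 else 1 in
  match l.1 with
  | Ga => shift s 0 g
  | Gb => shift 0 s g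
  | Gc => shift s s g
  | Gd => shift s (- s) g
  | Gs => cross (true, l.2) g
  | Gt => cross (false, l.2) g
  end.

Lemma oppK : involutive opp. Proof. by case=> b i; rewrite /opp /= negbK. Qed.
Lemma slope_in_opp e : slope_in (opp e) = slope_out e.
Proof. by case: e => b []. Qed.
Lemma slope_out_opp e : slope_out (opp e) = slope_in e.
Proof. by case: e => b []. Qed.
Lemma slope_slope_in e : slope (slope_in e).
Proof. by case: e => -[] []; rewrite /slope /slope_in /slope_out /sgn /=; lia. Qed.
Lemma slope_slope_out e : slope (slope_out e).
Proof. by case: e => -[] []; rewrite /slope /slope_in /slope_out /sgn /=; lia. Qed.

Variant cross_spec (e : stable) (g : state) : state -> Prop :=
| CrossPop st r x : g = State ((r, opp e) :: st) x (slope_in e * x) ->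
    cross_spec e g (State st x (r + slope_out e * x))
| CrossPush r : ~~ cancels r e (stack g) -> py g = r + slope_in e * px g ->
    cross_spec e g (State ((r, e) :: stack g) (px g) (slope_out e * px g)).

Lemma crossP e g : cross_spec e g (cross e g).
Proof.
case: g => [st x y]; rewrite /cross; set r := y - _.
have Ey : y = r + slope_in e * x by rewrite /r; lia.
case: st => [|[r' e'] st]; first exact: CrossPush.
case: ifPn => [/= /andP[/eqP Ee /Z.eqb_eq r0]|nc]; last exact: CrossPush.
by rewrite Ee slope_in_opp; apply: CrossPop; rewrite Ey r0.
Qed.

Arguments cross : simpl never.

Lemma cross_reduced e g : reduced g -> reduced (cross e g).
Proof.
move=> rg; case: crossP => [st r x Eg|r nc _].
  by move: rg; rewrite Eg /reduced /= => /andP[].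
by rewrite /reduced /= nc.
Qed.

Lemma act_reduced g l : reduced g -> reduced (act g l).
Proof. by case: l => -[] b rg; rewrite /act //=; apply: cross_reduced. Qed.

Lemma foldl_reduced g w : reduced g -> reduced (foldl act g w).
Proof. by elim: w g => //= l w IHw g rg; apply/IHw/act_reduced. Qed.

Lemma cross_push e st x y : ~~ cancels (y - slope_in e * x) e st ->
  cross e (State st x y) =
  State ((y - slope_in e * x, e) :: st) x (slope_out e * x).
Proof. by rewrite /cross; case: st => [|[r' e'] st] // /negPf ->. Qed.

Lemma cross_pop e st r x :
  cross (opp e) (State ((r, e) :: st) x (slope_out e * x)) =
  State st x (r + slope_in e * x).
Proof.
by rewrite /cross /cancels oppK eqxx slope_in_opp Z.sub_diag.
Qed.

(** The conjugation relation of the stable letter [e], as an identity between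
actions; for [k = 0] it says that [e] acts invertibly. *)
Lemma cross_shift_cross e g k : reduced g ->
  cross (opp e) (shift k (slope_out e * k) (cross e g)) =
  shift k (slope_in e * k) g.
Proof.
move=> rg; case: (crossP e g) => [st r x Eg|r nc Ey].
  move: rg; rewrite Eg /reduced /shift /= => /andP[nc _].
  rewrite cross_push slope_in_opp.
    rewrite slope_out_opp; congr State; try lia.
    by congr cons; congr pair; lia.
  by have -> : r + slope_out e * x + slope_out e * k - slope_out e * (x + k) = r by lia.
rewrite /shift /= -Z.mul_add_distr_l cross_pop; congr State; lia.
Qed.

Lemma crossK e g : reduced g -> cross (opp e) (cross e g) = g.
Proof.
move=> rg; have := cross_shift_cross e g 0 rg; rewrite /shift !Z.mul_0_r !Z.add_0_r.
by case: (cross e g) => [? ? ?] /= ->; case: (g).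
Qed.

Definition inv_letter (l : gen11 * bool) := (l.1, ~~ l.2).

Lemma actK g l : reduced g -> act (act g l) (inv_letter l) = g.
Proof.
case: l => x b rg.
have Es dx dy : shift (- dx) (- dy) (shift dx dy g) = g.
  by case: (g) => ? ? ?; rewrite /shift /=; congr State; lia.
case: x; rewrite /act /inv_letter /=.
- by rewrite -[RHS](Es (if b then -1 else 1) 0); case: (b).
- by rewrite -[RHS](Es 0 (if b then -1 else 1)); case: (b).
- by rewrite -[RHS](Es (if b then -1 else 1) (if b then -1 else 1)); case: (b).
- by rewrite -[RHS](Es (if b then -1 else 1) (- (if b then -1 else 1))); case: (b).
- exact: crossK (true, b) _ rg.
- exact: crossK (false, b) _ rg.
Qed.

(** To leave a coset one walks to some point [k] of its entry line and undoes the
last stable letter, which leads to the point [k] of the matching line of the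
preceding coset. *)
Fixpoint level (st : seq (Z * stable)) (x y : Z) : Z :=
  if st is (r, e) :: st' then
    1 + conv (slope_out e) (fun k => level st' k (r + slope_in e * k)) x y
  else king x y.
Definition len (g : state) : Z := level (stack g) (px g) (py g).

Lemma nearly_convex_abs : nearly_convex Z.abs.
Proof.
split=> [k|i j|k i j ij]; [lia|lia|].
by have := Z.pow_nonneg 2 (Z.of_nat k); lia.
Qed.

(** The base coset fits the general pattern, with its own horizontal axis in the
role of the entry line. *)
Lemma conv_abs x y : conv 0 Z.abs x y = king x y.
Proof.
have s0 : slope 0 by left.
have [k E _] := conv_attained x y s0 (nearly_convex_lip nearly_convex_abs); move: E.
have := @conv_le 0 _ x y 0 s0 (nearly_convex_lip nearly_convex_abs).
by rewrite /cost /king; lia.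
Qed.

(** A description of the word length on a coset that is uniform in the depth of
its stack. *)
Lemma level_conv st : exists e f c, [/\ slope e, nearly_convex f, 0 <= c &
  forall x y, level st x y = c + conv e f x y].
Proof.
elim: st => [|[r e] st [e' [f [c [sle' gf c0 E]]]]].
  exists 0, Z.abs, 0; split; [by left|exact: nearly_convex_abs|lia|].
  by move=> x y; rewrite conv_abs.
exists (slope_out e), (fun k => level st k (r + slope_in e * k)), 1.
split=> //; first exact: slope_slope_out.
have [g0 gl gc] := conv_nearly_convex 0 r sle' (slope_slope_in e) gf.
split=> [k|i j|n i j ij]; rewrite !E.
- by have := g0 k; rewrite Z.add_0_l; lia.
- by have := gl i j; rewrite !Z.add_0_l; lia.
- by have := gc n i j ij; rewrite !Z.add_0_l; lia.
Qed.

Lemma level_lip st x y x' y' : level st x y <= level st x' y' + king (x - x') (y - y').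
Proof.
have [e [f [c [sle gf c0 E]]]] := level_conv st.
by have := @conv_lip e f x y x' y' sle (nearly_convex_lip gf); rewrite !E; lia.
Qed.

Lemma level_ge0 st x y : 0 <= level st x y.
Proof.
have [e [f [c [sle gf c0 E]]]] := level_conv st.
have [k Ek _] := conv_attained x y sle (nearly_convex_lip gf).
by have := nearly_convex_ge0 gf k; rewrite E Ek /cost /king; lia.
Qed.

Lemma lip_parent st r e : lip (fun k => level st k (r + slope_in e * k)).
Proof.
move=> i j.
have := level_lip st i (r + slope_in e * i) j (r + slope_in e * j).
by rewrite /king; case: (slope_slope_in e) => [|[]] ->; lia.
Qed.

Lemma level_pop st r e x :
  level ((r, e) :: st) x (slope_out e * x) = 1 + level st x (r + slope_in e * x).
Proof.
have sle := slope_slope_out e; have lipf := @lip_parent st r e.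
have := @conv_le _ _ x (slope_out e * x) x sle lipf.
have [k E _] := conv_attained x (slope_out e * x) sle lipf; rewrite /level -/level {}E.
have := lipf x k; rewrite /cost /king; case: sle => [|[]] ->; lia.
Qed.

Lemma len_act g l : len (act g l) <= len g + 1.
Proof.
(* a push starts, and a pop ends, at a point of the entry line, where the
   length is given by level_pop *)
have len_cross e : len (cross e g) <= len g + 1.
  case: crossP => [st r x ->|r _ Ey]; rewrite /len.
    have := level_pop st r (opp e) x.
    by rewrite slope_out_opp slope_in_opp; cbn [stack px py]; lia.
  have := level_pop (stack g) r e (px g).
  by rewrite -Ey; cbn [stack px py]; lia.
have len_shift dx dy : king dx dy <= 1 -> len (shift dx dy g) <= len g + 1.
  have := level_lip (stack g) (px g + dx) (py g + dy) (px g) (py g).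
  by rewrite /len; cbn [stack px py shift]; rewrite /king; lia.
by case: l => -[] []; first [exact: len_shift | exact: len_cross].
Qed.

(** * Paths of vertices inside a ball *)

Inductive vpath (N : Z) : nat -> state -> state -> Prop :=
| vpath_nil g : len g <= N -> vpath N 0 g g
| vpath_cons g l n h : len g <= N -> vpath N n (act g l) h -> vpath N n.+1 g h.

Lemma vpath_trans N m n g h k :
  vpath N m g h -> vpath N n h k -> vpath N (m + n)%N g k.
Proof.
elim=> // {}g l {}m {}h gN _ IH q.
by rewrite addSn; apply: vpath_cons gN (IH q).
Qed.
Lemma vpath_end N n g h : vpath N n g h -> len h <= N.
Proof. by elim. Qed.
Lemma vpath_start N n g h : vpath N n g h -> len g <= N.
Proof. by case. Qed.
Lemma vpath_reduced N n g h : vpath N n g h -> reduced g -> reduced h.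
Proof. by elim=> // {}g l {}n {}h _ _ IH /act_reduced - /(_ l). Qed.

Lemma vpath_rev N n g h : reduced g -> vpath N n g h -> vpath N n h g.
Proof.
move=> + p; elim: p => [{}g gN _|{}g l {}n {}h gN p IH rg]; first exact: vpath_nil.
rewrite -addn1; apply: vpath_trans (IH (act_reduced _ l rg)) _.
apply: (@vpath_cons _ _ (inv_letter l)); first exact: vpath_start p.
by rewrite actK //; apply: vpath_nil.
Qed.

Lemma shift_letter dx dy : king dx dy = 1 -> exists l, forall g, act g l = shift dx dy g.
Proof.
move=> d1; have {d1} : [\/ (dx = 1 \/ dx = -1) /\ dy = 0,
  dx = 0 /\ (dy = 1 \/ dy = -1), (dx = 1 \/ dx = -1) /\ dy = dx |
  (dx = 1 \/ dx = -1) /\ dy = - dx].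
  move: d1; rewrite /king => d1.
  have [?|?] := Z.eq_dec dy 0; first by apply: Or41; lia.
  have [?|?] := Z.eq_dec dx 0; first by apply: Or42; lia.
  have [?|?] := Z.eq_dec dy dx; first by apply: Or43; lia.
  by apply: Or44; lia.
by case=> -[E1 E2];
 [case: E1 E2 => -> ->|case: E2 E1 => -> ->|case: E1 E2 => -> ->
 |case: E1 E2 => -> ->];
 [exists (Ga, false)|exists (Ga, true)|exists (Gb, false)|exists (Gb, true)
 |exists (Gc, false)|exists (Gc, true)|exists (Gd, false)|exists (Gd, true)].
Qed.

(** Every step shortens the king distance to the target, so the walk stays in the
king ball around the target whose boundary contains the start. *)
Lemma walk_to N st x' y' n x y : king (x' - x) (y' - y) = Z.of_nat n ->
  (forall u v, king (x' - u) (y' - v) <= Z.of_nat n -> level st u v <= N) ->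
  vpath N n (State st x y) (State st x' y').
Proof.
elim: n x y => [|n IHn] x y d near.
  have Ex : x = x' by move: d; rewrite /king; lia.
  have Ey : y = y' by move: d; rewrite /king; lia.
  by rewrite {}Ex {}Ey in d *; apply/vpath_nil/near; rewrite d.
have [l El] := @shift_letter (Z.sgn (x' - x)) (Z.sgn (y' - y))
  ltac:(move: d; rewrite /king; lia).
apply: (@vpath_cons _ _ l); first by apply/near; rewrite d; lia.
rewrite El; apply: IHn => [|u v uv]; last by apply/near; lia.
by move: d; rewrite /king /=; lia.
Qed.

Lemma king_opp x y : king (- x) (- y) = king x y.
Proof. by rewrite /king !Z.abs_opp. Qed.

Lemma king_sub x y x' y' : king (x - x') (y - y') = king (x' - x) (y' - y).
Proof. by rewrite -king_opp; congr king; lia. Qed.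

Lemma king_ge0 x y : 0 <= king x y. Proof. by rewrite /king; lia. Qed.

Lemma king_triangle x y u v : king (x + u) (y + v) <= king x y + king u v.
Proof. by rewrite /king; lia. Qed.

Lemma stable_letter e : exists l, forall g, act g l = cross e g.
Proof. by case: e => -[] b; [exists (Gs, b)|exists (Gt, b)]. Qed.

Lemma level_attained st r e x y : exists2 k,
  level ((r, e) :: st) x y =
    1 + level st k (r + slope_in e * k) + cost (slope_out e) x y k &
  forall k', cost (slope_out e) x y k <= cost (slope_out e) x y k'.
Proof.
have sle := slope_slope_out e.
have [k E C] := conv_attained x y sle (@lip_parent st r e).
exists k => [|k']; last exact: (@centred_closest _ _ _ _ sle C k').
by rewrite /level -/level E Z.add_assoc.
Qed.

Lemma level_le_cost st r e x y k : level ((r, e) :: st) x y <=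
    1 + level st k (r + slope_in e * k) + cost (slope_out e) x y k.
Proof.
have := @conv_le _ _ x y k (slope_slope_out e) (@lip_parent st r e).
by rewrite /level -/level; lia.
Qed.

(** Walking to an optimal point of the entry line and popping there lowers the
length at every step. *)
Lemma pop_path N st r e x y : level ((r, e) :: st) x y <= N ->
  exists k m, [/\ cost (slope_out e) x y k = Z.of_nat m,
    forall k', cost (slope_out e) x y k <= cost (slope_out e) x y k',
    level ((r, e) :: st) x y = level st k (r + slope_in e * k) + Z.of_nat m.+1 &
    vpath N m.+1 (State ((r, e) :: st) x y) (State st k (r + slope_in e * k))].
Proof.
move=> leN; have [k Ek kmin] := level_attained st r e x y.
have c0 : 0 <= cost (slope_out e) x y k by apply: king_ge0.
exists k, (Z.to_nat (cost (slope_out e) x y k)).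
split=> //; [lia|lia|].
have [l El] := stable_letter (opp e).
have pop : act (State ((r, e) :: st) k (slope_out e * k)) l =
    State st k (r + slope_in e * k) by rewrite El cross_pop.
rewrite -addn1; apply: (@vpath_trans _ _ _ _ (State ((r, e) :: st) k (slope_out e * k))).
  apply: walk_to => [|u v uv]; first by rewrite king_sub Z2Nat.id.
  apply: Z.le_trans (level_le_cost st r e u v k) _.
  by move: uv; rewrite king_sub -/(cost _ _ _ _); lia.
have end_le : level ((r, e) :: st) k (slope_out e * k) <= N by rewrite level_pop; lia.
apply: (@vpath_cons _ _ l) => //; rewrite pop; apply: vpath_nil.
by move: end_le; rewrite level_pop /len [stack _]/= [px _]/= [py _]/=; lia.
Qed.

Lemma descend N st x y : level st x y <= N ->
  vpath N (Z.to_nat (level st x y)) (State st x y) origin.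
Proof.
elim: st x y => [|[r e] st IH] x y leN.
  have king0 u v : king (0 - u) (0 - v) = king u v.
    by rewrite king_sub !Z.sub_0_r.
  apply: walk_to => [|u v]; rewrite king0 Z2Nat.id //; try exact: king_ge0.
  by move=> uv; apply: Z.le_trans leN.
have [k [m [_ _ Em p]]] := pop_path st r e x y leN.
have l0 := level_ge0 st k (r + slope_in e * k).
have -> : Z.to_nat (level ((r, e) :: st) x y) =
    (m.+1 + Z.to_nat (level st k (r + slope_in e * k)))%N.
  by rewrite Em -plusE; lia.
by apply: vpath_trans p _; apply: IH; lia.
Qed.

Lemma walk_line N st dx dy n x y : king dx dy = 1 ->
  (forall i, 0 <= i <= Z.of_nat n -> level st (x + i * dx) (y + i * dy) <= N) ->
  vpath N n (State st x y) (State st (x + Z.of_nat n * dx) (y + Z.of_nat n * dy)).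
Proof.
move=> d1; have [l El] := shift_letter dx dy d1.
elim: n x y => [|n IHn] x y leN.
  rewrite !Z.mul_0_l !Z.add_0_r; apply: vpath_nil.
  by have := leN 0; rewrite !Z.mul_0_l !Z.add_0_r; apply; lia.
apply: (@vpath_cons _ _ l).
  by have := leN 0; rewrite !Z.mul_0_l !Z.add_0_r; apply; lia.
have E z dz : z + Z.of_nat n.+1 * dz = z + dz + Z.of_nat n * dz by lia.
rewrite El !E; apply: IHn => i i_n.
have := leN (i + 1); have E' z dz : z + (i + 1) * dz = z + dz + i * dz by lia.
by rewrite !E'; apply; lia.
Qed.

(** [e * x + a] is the point of the vertical line through [(x, 0)] at height [a]
over the line of slope [e]. *)
Lemma conv_towards e f x a b : slope e -> lip f ->
  0 <= a <= b \/ b <= a <= 0 -> conv e f x (e * x + a) <= conv e f x (e * x + b).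
Proof.
move=> sle lipf; have main n c : (0 <= c -> conv e f x (e * x + c) <=
    conv e f x (e * x + (c + Z.of_nat n))) /\ (c <= 0 -> conv e f x (e * x + c) <=
    conv e f x (e * x + (c - Z.of_nat n))).
  elim: n => [|n [IH1 IH2]]; first by rewrite Z.add_0_r Z.sub_0_r; lia.
  split=> c0.
    have := @conv_step_y e f x (e * x + (c + Z.of_nat n.+1)) (-1) sle lipf.
    have -> : e * x + (c + Z.of_nat n.+1) + -1 = e * x + (c + Z.of_nat n) by lia.
    by have := IH1 c0; lia.
  have := @conv_step_y e f x (e * x + (c - Z.of_nat n.+1)) 1 sle lipf.
  have -> : e * x + (c - Z.of_nat n.+1) + 1 = e * x + (c - Z.of_nat n) by lia.
  by have := IH2 c0; lia.
case=> ab.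
  have [+ _] := main (Z.to_nat (b - a)) a.
  have -> : a + Z.of_nat (Z.to_nat (b - a)) = b by lia.
  by lia.
have [_ +] := main (Z.to_nat (a - b)) a.
have -> : a - Z.of_nat (Z.to_nat (a - b)) = b by lia.
by lia.
Qed.

(** Both points are moved vertically to the same height over the entry line, which
does not increase the length; the lengths between two points of a parallel to
the entry line are bounded by those at its ends. *)
Lemma vpath_coset N st x y x' y' : reduced_stack st ->
  level st x y <= N -> level st x' y' <= N ->
  exists2 n, Z.of_nat n <= 3 * king (x - x') (y - y') &
    vpath N n (State st x y) (State st x' y').
Proof.
move=> rst; have [e [f [c [sle gf c0 E]]]] := level_conv st.
have lipf := nearly_convex_lip gf.
pose a u v := v - e * u; have Ea u v : a u v = v - e * u by [].
clearbody a.
(* z lies between 0 and both heights, and as close to them as possible *)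
have [z [zl zl' zsum]] : exists z, [/\ 0 <= z <= a x y \/ a x y <= z <= 0,
    0 <= z <= a x' y' \/ a x' y' <= z <= 0 &
    Z.abs (a x y - z) + Z.abs (a x' y' - z) = Z.abs (a x y - a x' y')].
  exists (Z.max (Z.min (a x y) 0) (Z.min (Z.max (a x y) 0) (a x' y'))).
  by split; lia.
have vert u v : 0 <= z <= a u v \/ a u v <= z <= 0 -> level st u v <= N ->
    level st u (e * u + z) <= N /\
    vpath N (Z.to_nat (Z.abs (a u v - z))) (State st u v) (State st u (e * u + z)).
  move=> uvz leN; have towards b : 0 <= b <= a u v \/ a u v <= b <= 0 ->
      level st u (e * u + b) <= N.
    move=> bP; have := @conv_towards e f u b (a u v) sle lipf bP.
    have -> : e * u + a u v = v by have := Ea u v; lia.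
    by move: leN; rewrite !E; lia.
  split; first exact: towards.
  have [up|dn] := Z_le_gt_dec z (a u v).
    have := @walk_line N st 0 (-1) (Z.to_nat (Z.abs (a u v - z))) u v erefl.
    have -> : v + Z.of_nat (Z.to_nat (Z.abs (a u v - z))) * -1 = e * u + z.
      by rewrite Z2Nat.id; have := Ea u v; lia.
    rewrite Z.mul_0_r Z.add_0_r; apply => i i_n; rewrite Z.mul_0_r Z.add_0_r.
    have -> : v + i * -1 = e * u + (a u v - i) by have := Ea u v; lia.
    by apply: towards; lia.
  have := @walk_line N st 0 1 (Z.to_nat (Z.abs (a u v - z))) u v erefl.
  have -> : v + Z.of_nat (Z.to_nat (Z.abs (a u v - z))) * 1 = e * u + z.
    by rewrite Z2Nat.id; have := Ea u v; lia.
  rewrite Z.mul_0_r Z.add_0_r; apply => i i_n; rewrite Z.mul_0_r Z.add_0_r.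
  have -> : v + i * 1 = e * u + (a u v + i) by have := Ea u v; lia.
  by apply: towards; lia.
move=> /(vert _ _ zl)[leN p] /(vert _ _ zl')[leN' /vpath_rev p'].
have along u u' : u <= u' -> level st u (e * u + z) <= N -> level st u' (e * u' + z) <= N ->
    vpath N (Z.to_nat (u' - u)) (State st u (e * u + z)) (State st u' (e * u' + z)).
  move=> uu leu leu'.
  have := @walk_line N st 1 e (Z.to_nat (u' - u)) u (e * u + z).
  have -> : u + Z.of_nat (Z.to_nat (u' - u)) * 1 = u' by lia.
  have -> : e * u + z + Z.of_nat (Z.to_nat (u' - u)) * e = e * u' + z.
    by rewrite Z2Nat.id; lia.
  apply=> [|i i_n]; first by rewrite /king; case: sle => [|[]] ->.
  have := nearly_convex_between (conv_nearly_convex 0 z sle sle gf) (i := u) (k := u + i) (j := u').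
  rewrite !Z.add_0_l; move: leu leu'; rewrite !E.
  have -> : u + i * 1 = u + i by lia.
  have -> : e * u + z + i * e = z + e * (u + i) by lia.
  by rewrite ![e * _ + z]Z.add_comm; lia.
have [n nP q] : exists2 n, Z.of_nat n = Z.abs (x - x') &
    vpath N n (State st x (e * x + z)) (State st x' (e * x' + z)).
  exists (Z.to_nat (Z.abs (x - x'))); first lia.
  have [le|gt] := Z_le_gt_dec x x'.
    have -> : Z.abs (x - x') = x' - x by lia.
    exact: along.
  have -> : Z.abs (x - x') = x - x' by lia.
  by apply: vpath_rev => //; apply: along => //; lia.
exists (Z.to_nat (Z.abs (a x y - z)) + n + Z.to_nat (Z.abs (a x' y' - z)))%N.
  rewrite -!plusE !Nat2Z.inj_add !Z2Nat.id ?nP; try lia.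
  have := Ea x y; have := Ea x' y'; rewrite /king.
  by case: sle => [|[]] ->; lia.
by apply: vpath_trans (vpath_trans p q) _; apply: p'.
Qed.

(** * Crossing between cosets of the lattice *)

(** [downward p k g h]: [h] can be reached from [g] with [p] pops and at most [k]
letters, by lattice moves and pops only.  The displacement within each coset is
recorded by its king length. *)
Inductive downward : nat -> Z -> state -> state -> Prop :=
| downward_flat k st x y x' y' : king (x - x') (y - y') <= k ->
    downward 0 k (State st x y) (State st x' y')
| downward_pop p m k r e st x y c h : cost (slope_out e) x y c <= m ->
    downward p k (State st c (r + slope_in e * c)) h ->
    downward p.+1 (m + 1 + k) (State ((r, e) :: st) x y) h.

Lemma downward_ge0 p k g h : downward p k g h -> 0 <= k.
Proof.
elim=> [{}k st x y x' y'|{}p m {}k r e st x y c {}h].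
  by have := king_ge0 (x - x') (y - y'); lia.
by have := king_ge0 (x - c) (y - slope_out e * c); rewrite /cost; lia.
Qed.

Lemma downward_refl g : downward 0 0 g g.
Proof. by case: g => st x y; apply: downward_flat; rewrite !Z.sub_diag. Qed.

Lemma downward_near p k m st x y x' y' h :
  downward p k (State st x y) h -> king (x' - x) (y' - y) <= m ->
  downward p (k + m) (State st x' y') h.
Proof.
move Eg: (State st x y) => g d; case: d Eg.
  move=> {}k st' x0 y0 u v uv [-> -> ->] near; apply: downward_flat.
  have := king_triangle (x' - x0) (y' - y0) (x0 - u) (y0 - v).
  have -> : x' - x0 + (x0 - u) = x' - u by lia.
  have -> : y' - y0 + (y0 - v) = y' - v by lia.
  by lia.
move=> {}p m' {}k r e st' x0 y0 c {}h cm d [-> -> ->] near.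
have -> : m' + 1 + k + m = (m' + m) + 1 + k by lia.
apply: downward_pop d; apply: Z.le_trans (Z.add_le_mono _ _ _ _ cm near).
have := king_triangle (x' - x0) (y' - y0) (x0 - c) (y0 - slope_out e * c).
have -> : x' - x0 + (x0 - c) = x' - c by lia.
have -> : y' - y0 + (y0 - slope_out e * c) = y' - slope_out e * c by lia.
by rewrite /cost; lia.
Qed.

Arguments downward_near {p k m st x y x' y' h} _ _.

Lemma downward_extend p k m g r e st x y c :
  downward p k g (State ((r, e) :: st) x y) -> cost (slope_out e) x y c <= m ->
  downward p.+1 (k + (m + 1)) g (State st c (r + slope_in e * c)).
Proof.
move Eh: (State _ x y) => h d; elim: d Eh.
  move=> {}k st' u v x' y' uv [<- Ex Ey] near; rewrite -{}Ex -{}Ey in uv.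
  have -> : k + (m + 1) = (k + m) + 1 + 0 by lia.
  apply: (@downward_pop _ _ _ _ _ _ _ _ c); last exact: downward_refl.
  have := king_triangle (u - x) (v - y) (x - c) (y - slope_out e * c).
  have -> : u - x + (x - c) = u - c by lia.
  have -> : v - y + (y - slope_out e * c) = v - slope_out e * c by lia.
  by move: near; rewrite /cost; lia.
move=> {}p m' {}k r' e' st' u v c' h' c'm _ IH Eh near.
rewrite -Z.add_assoc; apply: downward_pop c'm _; exact: IH.
Qed.

(** In the ball one has to pop at an optimal point of the entry line instead of the
prescribed one.  Both are within [m] of the start, hence within [2 * m] of
each other; the detour is carried over to the preceding coset, and the factor 3
accounts for it. *)
Lemma downward_vpath N p k st x y h :
  downward p k (State st x y) h -> level st x y <= N ->
  exists n u v, [/\ Z.of_nat n <= 3 ^ Z.of_nat p * k,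
    king (u - px h) (v - py h) <= 3 ^ Z.of_nat p * k &
    vpath N n (State st x y) (State (stack h) u v)].
Proof.
elim: st p k x y h => [|[r e] st IH] p k x y h + leN; move Eg: (State _ x y) => g d.
  have k0 := downward_ge0 d; case: d Eg k0 => // k' st x0 y0 x' y' near [Est Ex Ey] k0.
  rewrite -Est -Ex -Ey in near *.
  by exists 0%N, x, y; rewrite Z.mul_1_l; split=> //; apply: vpath_nil.
have k0 := downward_ge0 d; case: d Eg k0.
  move=> {}k st0 x0 y0 x' y' near [Est Ex Ey] k0; rewrite -Est -Ex -Ey in near *.
  by exists 0%N, x, y; rewrite Z.mul_1_l; split=> //; apply: vpath_nil.
move=> {}p m {}k r0 e0 st0 x0 y0 c {}h cm d [Er Ee Est Ex Ey] _.
rewrite -{}Er -{}Ee -{}Est -{}Ex -{}Ey in cm d *.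
have [c' [n [En cmin El P]]] := pop_path st r e x y leN.
have nm : Z.of_nat n <= m by have := cmin c; lia.
(* c is the prescribed point of the entry line, c' the optimal one *)
have near : king (c' - c) (r + slope_in e * c' - (r + slope_in e * c)) <= 2 * m.
  have := cmin c; move: cm; rewrite /cost /king.
  by case: (slope_slope_in e) => [|[]] ->; lia.
have [|n' [u [v [n'P uvP P']]]] := IH _ _ _ _ _ (downward_near d near).
  by lia.
have k0 := downward_ge0 d.
have pow1 : 1 <= 3 ^ Z.of_nat p by have := Z.pow_pos_nonneg 3 (Z.of_nat p); lia.
have pow3 : 3 ^ Z.of_nat p.+1 = 3 * 3 ^ Z.of_nat p.
  by rewrite Nat2Z.inj_succ Z.pow_succ_r //; lia.
exists (n.+1 + n')%N, u, v; split; last exact: vpath_trans P P'.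
  by rewrite -plusE pow3; nia.
by rewrite pow3; nia.
Qed.

(** Joined by at most [n] letters through a route that first pops and then pushes. *)
Definition valley (n : nat) (g h : state) : Prop :=
  exists f p q k1 k2, [/\ downward p k1 g f, downward q k2 h f,
    (p + q <= n)%N & k1 + k2 <= Z.of_nat n].

(** A letter at the end of the route is absorbed.  The only delicate case is a pop
after a push: the excursion above the line between the two is replaced by the
walk along the line between its ends, which is no longer. *)
Lemma valley_act n g h l : valley n g h -> valley n.+1 g (act h l).
Proof.
move=> [f [p [q [k1 [k2 [dg dh pq k12]]]]]].
have flat dx dy : king dx dy <= 1 -> valley n.+1 g (shift dx dy h).
  move=> d1; exists f, p, q, k1, (k2 + 1); split=> //; [|exact: leqW|lia].
  case: h dh => st x y dh; apply: downward_near dh _.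
  by rewrite /= !Z.add_simpl_l; lia.
have crossing e : valley n.+1 g (cross e h).
  case: crossP dh => [st r x -> dh|r _ Ey dh]; last first.
    exists f, p, q.+1, k1, (0 + 1 + k2); split=> //; [|by rewrite addnS|lia].
    apply: (@downward_pop _ _ _ _ _ _ _ _ (px h)); last by rewrite -Ey; case: (h) dh.
    by rewrite /cost !Z.sub_diag.
  (* either f lies in the coset of h, or the route from f to h enters this coset
     by the push that the pop undoes *)
  rewrite -slope_in_opp; move: dh; rewrite -slope_out_opp.
  move: (opp e) => {}e dh.
  move Eh: (State _ x _) dh => h' dh; case: dh Eh dg pq k12.
    move=> {}k2 st0 x0 y0 u v uv [Est Ex Ey] dg pq k12.
    rewrite -{}Est -{}Ex -{}Ey in uv dg.
    exists (State st x (r + slope_in e * x)), p.+1, 0%N, (k1 + (k2 + 1)), 0.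
    split; [|exact: downward_refl| |lia].
      by apply: downward_extend dg _; rewrite /cost king_sub.
    by rewrite addn0 ltnS (leq_trans _ pq) ?leq_addr.
  move=> {}q m {}k2 r0 e0 st0 x0 y0 c {}f cm dh [Er Ee Est Ex Ey] dg pq k12.
  rewrite -{}Er -{}Ee -{}Est -{}Ex -{}Ey in cm dh.
  exists f, p, q, k1, (k2 + m); split=> //; [|by rewrite (leq_trans _ (leqW pq)) // leq_add2l leqnSn|lia].
  apply: downward_near dh _; move: cm; rewrite /cost /king.
  by case: (slope_slope_in e) => [|[]] ->; lia.
by case: l => -[] []; first [exact: flat | exact: crossing].
Qed.

Lemma valley_refl g : valley 0 g g.
Proof.
case: g => st x y; exists (State st x y), 0%N, 0%N, 0, 0.
by split=> //; apply: downward_refl.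
Qed.

Lemma valley_word w g : valley (size w) g (foldl act g w).
Proof.
elim/last_ind: w => [|w l IHw]; first exact: valley_refl.
by rewrite size_rcons foldl_rcons; apply: valley_act.
Qed.

(** Almost convexity for vertices, at every distance. *)
Lemma vpath_word n : exists C : nat, forall N g w, reduced g -> (size w <= n)%N ->
  len g <= N -> len (foldl act g w) <= N ->
  exists2 m, (m <= C)%N & vpath N m g (foldl act g w).
Proof.
pose B := 3 ^ Z.of_nat n * Z.of_nat n.
exists (Z.to_nat (8 * B)) => N g w rg wn gN hN.
have [f [p [q [k1 [k2 [dg dh pq k12]]]]]] := valley_word w g.
have bound s k : (s <= size w)%N -> 0 <= k <= Z.of_nat (size w) -> 3 ^ Z.of_nat s * k <= B.
  move=> sw kw; apply: Z.mul_le_mono_nonneg; [lia| |lia|].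
    by apply: Z.pow_le_mono_r; [lia|apply/inj_le/leP/(leq_trans sw wn)].
  by apply: (Z.le_trans _ _ _ (proj2 kw)); apply/inj_le/leP.
have k10 := downward_ge0 dg; have k20 := downward_ge0 dh.
have Bp := bound p k1 (leq_trans (leq_addr _ _) pq) ltac:(lia).
have Bq := bound q k2 (leq_trans (leq_addl _ _) pq) ltac:(lia).
have rh := foldl_reduced _ w rg.
move: (foldl act g w) => h in hN dh rh *.
case: g h => [st x y] [st' x' y'] in dg dh gN hN rg rh *.
have [m1 [u1 [v1 [m1B uv1 P1]]]] := downward_vpath dg gN.
have [m2 [u2 [v2 [m2B uv2 P2]]]] := downward_vpath dh hN.
have rf := vpath_reduced P1 rg.
have [m3 m3B P3] := @vpath_coset N _ u1 v1 u2 v2 rf (vpath_end P1) (vpath_end P2).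
exists (m1 + m3 + m2)%N.
  have B0 : 0 <= B by apply: Z.mul_nonneg_nonneg; lia.
  apply/leP/Nat2Z.inj_le; rewrite -!plusE Z2Nat.id; last lia.
  have : king (u1 - u2) (v1 - v2) <= 2 * B by move: uv1 uv2; rewrite /king; lia.
  by lia.
exact: vpath_trans (vpath_trans P1 P3) (vpath_rev rh P2).
Qed.

Local Close Scope Z_scope.

(** * Normal forms parametrize the group *)

Local Open Scope group_scope.

Definition zpow {G : groupType} (g : G) (z : Z) : G :=
  if Z.leb 0 z then g ^+ Z.to_nat z else g ^- Z.to_nat (- z).

Lemma zpowS {G : groupType} (g : G) (z : Z) : zpow g (z + 1) = zpow g z * g.
Proof.
rewrite /zpow; case: (Z.leb_spec 0 z) => z0.
  have -> : Z.leb 0 (z + 1) = true by apply/Z.leb_le; lia.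
  have -> : Z.to_nat (z + 1) = (Z.to_nat z).+1 by lia.
  by rewrite expgSr.
have [z1|z1] := Z.eq_dec z (-1).
  by rewrite z1 /= mulVg.
have -> : Z.leb 0 (z + 1) = false by apply/Z.leb_gt; lia.
have -> : Z.to_nat (- z) = (Z.to_nat (- (z + 1))).+1 by lia.
by rewrite expgS invgM mulgVK.
Qed.

Lemma zpow0 {G : groupType} (g : G) : zpow g 0 = 1. Proof. by []. Qed.
Lemma zpow1 {G : groupType} (g : G) : zpow g 1 = g.
Proof. by rewrite (zpowS g 0) zpow0 mul1g. Qed.
Lemma zpowV1 {G : groupType} (g : G) : zpow g (-1) = g^-1. Proof. by []. Qed.

Lemma zpowB1 {G : groupType} (g : G) z : zpow g (z - 1) = zpow g z * g^-1.
Proof.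
by have := zpowS g (z - 1); rewrite Z.sub_add => ->; rewrite mulgK.
Qed.

Lemma zpowD {G : groupType} (g : G) y z : zpow g (y + z) = zpow g y * zpow g z.
Proof.
elim/Z.peano_ind: z => [|z IH|z IH].
- by rewrite Z.add_0_r mulg1.
- by rewrite -Z.add_1_r Z.add_assoc !zpowS IH mulgA.
- by rewrite -Z.sub_1_r Z.add_sub_assoc !zpowB1 IH mulgA.
Qed.

(** Conjugation commutes with powers, in a form that also covers commuting
elements. *)
Lemma zpow_swap {G : groupType} (g h k : G) z :
  g * k = k * h -> zpow g z * k = k * zpow h z.
Proof.
move=> gk; have gkV : g^-1 * k = k * h^-1.
  by apply: (mulgI g); rewrite mulVKg mulgA gk mulgK.
elim/Z.peano_ind: z => [|z IH|z IH]; first by rewrite mul1g mulg1.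
  by rewrite -Z.add_1_r !zpowS -mulgA gk !mulgA IH.
by rewrite -Z.sub_1_r !zpowB1 -mulgA gkV !mulgA IH.
Qed.

Lemma zpow_commute {G : groupType} (g h : G) y z :
  g * h = h * g -> zpow g y * zpow h z = zpow h z * zpow g y.
Proof. by move=> gh; apply: zpow_swap; apply/esym/zpow_swap. Qed.

Lemma zpowM {G : groupType} (g h : G) s z : g * h = h * g ->
  zpow (g * zpow h s) z = zpow g z * zpow h (s * z).
Proof.
move=> gh; elim/Z.peano_ind: z => [|z IH|z IH].
- by rewrite Z.mul_0_r mulg1.
- rewrite -Z.add_1_r Z.mul_add_distr_l Z.mul_1_r !zpowS IH zpowD.
  rewrite -!mulgA; congr (_ * _); rewrite !mulgA; congr (_ * _).
  by have := zpow_commute g h 1 (s * z) gh; rewrite zpow1.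
- rewrite -Z.sub_1_r Z.mul_sub_distr_l Z.mul_1_r !zpowB1 IH.
  rewrite invgM -!mulgA [zpow h (s * z) * _]mulgA.
  have -> : zpow h (s * z) * (zpow h s)^-1 = zpow h (s * z - s).
    by apply: (canLR (mulgK _)); rewrite -zpowD Z.sub_add.
  by have := zpow_commute g h (-1) (s * z - s) gh; rewrite zpowV1 => ->.
Qed.

Definition cls (w : word gen11) : G11 := presented_class rels11 w.
Definition gen (x : gen11) : G11 := presented_gen rels11 x.

Lemma cls_cat u v : cls (u ++ v) = cls u * cls v.
Proof. exact: presented_class_cat. Qed.

Lemma cls_letter x b : cls [:: (x, b)] = if b then (gen x)^-1 else gen x.
Proof.
case: b => //; have := presented_class_inv rels11 [:: (x, false)].
by rewrite /inv_word.
Qed.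

Lemma cls_rel u v : (u, v) \in rels11 -> cls u = cls v.
Proof. by move=> uv; apply/presented_classP/word_eq_rel. Qed.

Lemma cls_cons l w : cls (l :: w) = cls [:: l] * cls w.
Proof. by rewrite -cat1s cls_cat. Qed.

Lemma gen_c : gen Gc = gen Ga * gen Gb.
Proof.
have := @cls_rel [:: pos Gc] [:: pos Ga; pos Gb].
by rewrite (cls_cons (pos Ga)) !cls_letter; apply; rewrite !inE eqxx.
Qed.
Lemma gen_comm : gen Ga * gen Gb = gen Gb * gen Ga.
Proof.
have := @cls_rel [:: pos Gc] [:: pos Gb; pos Ga].
by rewrite (cls_cons (pos Gb)) !cls_letter -gen_c; apply; rewrite !inE eqxx orbT.
Qed.
Lemma gen_d : gen Gd = gen Ga * (gen Gb)^-1.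
Proof.
have := @cls_rel [:: pos Gd] [:: pos Ga; neg Gb].
by rewrite (cls_cons (pos Ga)) !cls_letter; apply; rewrite !inE eqxx !orbT.
Qed.
Lemma gen_s : gen Ga * gen Gs = gen Gs * gen Gc.
Proof.
have := @cls_rel [:: neg Gs; pos Ga; pos Gs] [:: pos Gc].
rewrite (cls_cons (neg Gs)) (cls_cons (pos Ga)) !cls_letter => <-.
  by rewrite mulVKg.
by rewrite !inE eqxx !orbT.
Qed.
Lemma gen_t : gen Ga * gen Gt = gen Gt * gen Gd.
Proof.
have := @cls_rel [:: neg Gt; pos Ga; pos Gt] [:: pos Gd].
rewrite (cls_cons (neg Gt)) (cls_cons (pos Ga)) !cls_letter => <-.
  by rewrite mulVKg.
by rewrite !inE eqxx !orbT.
Qed.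

Definition ab (x y : Z) : G11 := zpow (gen Ga) x * zpow (gen Gb) y.
Definition stable_gen (e : stable) : G11 :=
  cls [:: (if e.1 then Gs else Gt, e.2)].
Fixpoint stack_value (st : seq (Z * stable)) : G11 :=
  if st is (r, e) :: st' then stack_value st' * ab 0 r * stable_gen e else 1.
Definition value (g : state) : G11 := stack_value (stack g) * ab (px g) (py g).

Lemma abD x y u v : ab (x + u) (y + v) = ab x y * ab u v.
Proof.
rewrite /ab !zpowD -!mulgA; congr (_ * _); rewrite !mulgA; congr (_ * _).
exact/zpow_commute/gen_comm.
Qed.

Lemma stable_gen_opp e : stable_gen (opp e) = (stable_gen e)^-1.
Proof. by case: e => b []; rewrite /stable_gen !cls_letter ?invgK. Qed.

Lemma ab_stable e x :
  ab x (slope_in e * x) * stable_gen e = stable_gen e * ab x (slope_out e * x).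
Proof.
rewrite /ab -!(zpowM _ _ _ _ gen_comm); apply: zpow_swap.
have swapV (g h k : G11) : g * k = k * h -> h * k^-1 = k^-1 * g.
  by move=> gk; apply: (mulgI k); rewrite mulVKg mulgA -gk mulgK.
by case: e => -[] []; rewrite /stable_gen cls_letter /= ?zpow0 ?zpow1 ?zpowV1 ?mulg1
  -?gen_c -?gen_d; [apply/swapV/gen_s|exact: gen_s|apply/swapV/gen_t|exact: gen_t].
Qed.

(** The action of letters on states covers right multiplication; hence the state
reached from the origin determines the group element. *)
Lemma value_act g l : value (act g l) = value g * cls [:: l].
Proof.
have Vshift dx dy : value (shift dx dy g) = value g * ab dx dy.
  by rewrite /value /= abD mulgA.
have Vcross e : value (cross e g) = value g * stable_gen e.
  case: crossP => [st r x ->|r _ Ey]; rewrite /value; cbn [stack px py stack_value].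
    rewrite -[RHS]mulgA ab_stable stable_gen_opp [RHS]mulgA mulgVK.
    by rewrite -[RHS]mulgA -abD.
  rewrite Ey -[LHS]mulgA -ab_stable [LHS]mulgA.
  by rewrite -(mulgA (stack_value _) (ab _ _) (ab _ _)) -abD.
case: l => -[] b; rewrite /act; cbn [fst snd].
- by rewrite Vshift /ab cls_letter; case: b; rewrite mulg1 ?zpow1.
- by rewrite Vshift /ab cls_letter; case: b; rewrite mul1g ?zpow1.
- by rewrite Vshift /ab cls_letter gen_c; case: b; rewrite ?zpow1 // !zpowV1 gen_comm invgM.
- rewrite Vshift /ab cls_letter gen_d; case: b; rewrite ?zpow1 ?zpowV1 // invgM invgK.
  by have := zpow_commute _ _ (-1) 1 gen_comm; rewrite zpowV1 zpow1 => ->.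
- by rewrite Vcross.
- by rewrite Vcross.
Qed.

(** The relators act trivially on reduced states, so that the action is one of the
presented group. *)
Lemma word_eq_act u v : word_eq rels11 u v ->
  forall g, reduced g -> foldl act g u = foldl act g v.
Proof.
elim=> {u v} [//|u v _ IH g rg|u v w _ IHu _ IHv g rg|u u' v v' _ IHu _ IHv g rg
             |x b g rg|u v uv g rg].
- by rewrite IH.
- by rewrite IHu // IHv.
- by rewrite !foldl_cat IHu // IHv //; apply: foldl_reduced.
- exact: actK (x, b) rg.
have shiftD p q p' q' : shift p' q' (shift p q g) = shift (p + p') (q + q') g.
  by rewrite /shift /=; congr State; lia.
have conjugate b : cross (b, false) (shift 1 0 (cross (b, true) g)) = shift 1 (sgn b) g.
  by have := cross_shift_cross (b, true) g 1 rg; rewrite /= Z.mul_1_r.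
by move: uv; rewrite !inE => /or4P[|||/orP[]] /eqP[-> ->] /=; rewrite /act /= ?shiftD ?conjugate.
Qed.

Definition state_of (g : G11) : state := foldl act origin (repr g).

Lemma state_of_cls w : state_of (cls w) = foldl act origin w.
Proof. exact: word_eq_act (repr_presented_class rels11 w) _ _. Qed.

Lemma state_of1 : state_of 1 = origin.
Proof. exact: (state_of_cls [::]). Qed.

(** The normal form of a product can be computed by acting on that of the left
factor, which turns paths in the graph into sequences of letters. *)
Lemma state_of_mul g w : state_of (g * cls w) = foldl act (state_of g) w.
Proof.
have {1}-> : g = cls (repr g) by rewrite /cls presented_classK.
by rewrite -cls_cat state_of_cls foldl_cat.
Qed.

Lemma state_of_reduced g : reduced (state_of g).
Proof. exact: foldl_reduced. Qed.

Lemma state_ofK : cancel state_of value.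
Proof.
move=> g; have -> : value (state_of g) = cls (repr g); last exact: presented_classK.
rewrite /state_of; elim/last_ind: (repr g) => [|w l IHw].
  by rewrite /value /= /ab !zpow0 !mulg1.
by rewrite foldl_rcons value_act IHw -cls_cat cats1.
Qed.

(** * Word length and adjacency in the group *)

Import Order.TTheory GRing.Theory Num.Theory.

(** By [norm_cls] and [norm_word] this is the word length. *)
Definition norm (g : G11) : nat := Z.to_nat (len (state_of g)).

Lemma len_norm g : len (state_of g) = Z.of_nat (norm g).
Proof. by rewrite /norm Z2Nat.id //; apply: level_ge0. Qed.

Lemma state_of_inj : injective state_of.
Proof. exact: can_inj state_ofK. Qed.

Lemma norm1 : norm 1 = 0%N.
Proof. by rewrite /norm state_of1. Qed.

Lemma norm_letter g l : (norm (g * cls [:: l]) <= (norm g).+1)%N.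
Proof.
apply/ssrnat.leP; have := len_act (state_of g) l.
by rewrite -/(foldl act _ [:: l]) -state_of_mul !len_norm; lia.
Qed.

Lemma norm_cls w : (norm (cls w) <= size w)%N.
Proof.
elim/last_ind: w => [|w l IHw]; first by rewrite [cls _](_ : _ = 1) ?norm1.
by rewrite size_rcons -cats1 cls_cat; apply: leq_trans (norm_letter _ _) _.
Qed.

Lemma vpath_letters N n g h : vpath N n g h ->
  exists2 w, size w = n & h = foldl act g w.
Proof.
elim=> [{}g _|{}g l {}n {}h _ _ [w sw ->]]; first by exists [::].
by exists (l :: w); rewrite /= ?sw.
Qed.

Lemma norm_vpath g :
  vpath (Z.of_nat (norm g)) (norm g) origin (state_of g).
Proof.
apply: vpath_rev; first exact: state_of_reduced.
rewrite -len_norm /norm; case: (state_of g) => st x y.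
exact: (@descend _ st x y (Z.le_refl _)).
Qed.

Lemma norm_word g : exists2 w, size w = norm g & cls w = g.
Proof.
have [w sw Ew] := vpath_letters (norm_vpath g).
by exists w => //; apply: state_of_inj; rewrite state_of_cls.
Qed.

Lemma cayley_adjP g h : cayley_adj X11 g h <-> exists l, h = g * cls [:: l].
Proof.
have X11P k : X11 k <-> exists l, k = cls [:: l].
  split=> [[x [->|->]]|[[x b] ->]].
  - by exists (x, false).
  - by exists (x, true); rewrite cls_letter.
  - by exists x; rewrite cls_letter; case: b; [right|left].
split=> [[/X11P[l El]|/X11P[[x b] El]]|[l ->]].
- by exists l; rewrite -El mulVKg.
- exists (x, ~~ b); have -> : cls [:: (x, ~~ b)] = (cls [:: (x, b)])^-1.
    by rewrite !cls_letter; case: b {El}; rewrite ?invgK.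
  by rewrite -El invgM invgK mulVKg.
- by left; apply/X11P; exists l; rewrite mulKg.
Qed.

Lemma cayley_adj_sym (G : groupType) (X : set G) g h :
  cayley_adj X g h -> cayley_adj X h g.
Proof. by case=> ?; [right|left]. Qed.

Lemma norm_adj g h : cayley_adj X11 g h -> (norm g <= (norm h).+1)%N.
Proof. by move=> /cayley_adj_sym/cayley_adjP[l ->]; apply: norm_letter. Qed.

Lemma norm_adj_transl k g h : cayley_adj X11 g h ->
  (norm (k * g) <= (norm (k * h)).+1)%N.
Proof.
move=> /cayley_adj_sym/cayley_adjP[l ->]; rewrite mulgA; exact: norm_letter.
Qed.

(** A step towards the identity: undo the last letter of a shortest word. *)
Lemma norm_pred g n : (norm g <= n.+1)%N ->
  exists2 h, (norm h <= n)%N & exists2 w, (size w <= 1)%N & h = g * cls w.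
Proof.
have [w sw Ew] := norm_word g; rewrite -{}sw -{g}Ew.
case: (leqP (size w) n) => [le_n _|gt_n le_n].
  exists (cls w); first exact: leq_trans (norm_cls _) _.
  by exists [::] => //; rewrite -cls_cat cats0.
case/lastP: w le_n gt_n => [//|w l]; rewrite size_rcons !ltnS => le_n _.
exists (cls w); first exact: leq_trans (norm_cls _) _.
exists [:: (l.1, ~~ l.2)] => //.
have inv_l : cls [:: l] * cls [:: (l.1, ~~ l.2)] = 1.
  by rewrite !cls_letter; case: l {le_n} => x [] /=; rewrite !cls_letter ?mulVg ?mulgV.
by rewrite -cats1 cls_cat -mulgA inv_l mulg1.
Qed.

(** * Metric geometry of the Cayley graph *)

Unset Strict Implicit.
Local Open Scope ring_scope.
Local Open Scope classical_set_scope.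

Lemma cayley_ptC {R : realType} {G : groupType} (g h : G) (t : R) :
  cayley_pt g h t = cayley_pt h g (1 - t).
Proof. by apply/funext => v; rewrite /cayley_pt subKr addrC. Qed.

Lemma cayley_pt0 {R : realType} {G : groupType} (g h : G) : cayley_pt g h 0 = cayley_vertex R g.
Proof. by apply/funext => v; rewrite /cayley_pt subr0 mul1r mul0r addr0. Qed.

Lemma cayley_pt1 {R : realType} {G : groupType} (g h : G) : cayley_pt g h 1 = cayley_vertex R h.
Proof. by rewrite cayley_ptC subrr cayley_pt0. Qed.

(** If [f] is the distance from a base vertex, then some route of length at most [r]
from that vertex to [p] enters the edge of [p] at an endpoint [u]: the point [p]
is at distance [1 - p u] from [u]. *)
Definition reached {R : realType} {G : groupType} (f : G -> R) (p : G -> R) (r : R) : Prop :=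
  exists2 u, 0 < p u & f u + (1 - p u) <= r.

Lemma cayley_pt_refl {R : realType} {G : groupType} (g : G) (t : R) :
  cayley_pt g g t = cayley_vertex R g.
Proof. by apply/funext => v; rewrite /cayley_pt -mulrDl subrK mul1r. Qed.

Lemma cayley_pt_l {R : realType} {G : groupType} (g h : G) (t : R) : g != h ->
  cayley_pt g h t g = 1 - t.
Proof. by move=> /negPf gh; rewrite /cayley_pt eqxx gh mulr1 mulr0 addr0. Qed.

Lemma cayley_pt_support {R : realType} {G : groupType} (g h : G) (t : R) u :
  0 < cayley_pt g h t u -> u = g \/ u = h.
Proof.
rewrite /cayley_pt; case: eqP => [->|_]; first by left.
by case: eqP => [->|_]; [right|rewrite !mulr0 addr0 ltxx].
Qed.

Lemma reached_segment {R : realType} {G : groupType} (X : set G) (f : G -> R) g h (s t r : R) :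
  (forall g h, cayley_adj X g h -> f g <= f h + 1) ->
  cayley_adj X g h -> 0 <= s <= 1 -> 0 <= t <= 1 ->
  reached f (cayley_pt g h s) r -> reached f (cayley_pt g h t) (r + `|s - t|).
Proof.
move=> lipf gh s01 t01 [u pu fu].
have [Egh|neq] := eqVneq g h.
  move: pu fu; rewrite -Egh !cayley_pt_refl => pu fu.
  by exists u => //; apply: le_trans fu _; rewrite lerDl.
(* exchanging g and h reverses the parameter *)
wlog Eu : g h s t gh s01 t01 pu fu neq / u = g.
  move=> H; case: (cayley_pt_support pu) => Eu; first exact: (H g h).
  have -> : `|s - t| = `|(1 - s) - (1 - t)| by rewrite distrC; congr `|_|; lra.
  rewrite cayley_ptC; apply: H => //; first exact: cayley_adj_sym.
  - by lra.
  - by lra.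
  - by rewrite -cayley_ptC.
  - by rewrite -cayley_ptC.
  - by rewrite eq_sym.
move: pu fu; rewrite {}Eu cayley_pt_l // => pu fu.
have st := ler_norm (s - t); have ts := ler_norm (t - s).
rewrite distrC in ts.
(* at t = 1 the vertex g is not an endpoint any more, and h takes over *)
have [t1|tN1] := eqVneq t 1.
  exists h; rewrite t1 cayley_pt1 /cayley_vertex eqxx mulr1n ?ltr01 //.
  by have := lipf h g (cayley_adj_sym gh); rewrite t1 in ts; lra.
exists g; rewrite cayley_pt_l //; first by rewrite subr_gt0 lt_neqAle tN1; case/andP: t01.
by lra.
Qed.

(** A lower bound for the length of paths: moving along an edge changes the
distance from the base vertex at most by the length of the move. *)
Lemma reached_path {R : realType} {G : groupType} (X : set G) B (f : G -> R) p q l r :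
  (forall g h, cayley_adj X g h -> f g <= f h + 1) ->
  cayley_path X B p q l -> reached f p r -> reached f q (r + l).
Proof.
move=> lipf path; elim: path r => [{}p _ r|g h s t {}q {}l gh s01 t01 _ _ IH r].
  by rewrite addr0.
by move=> /(reached_segment lipf gh s01 t01)/IH; rewrite addrA.
Qed.

Lemma dist_path {R : realType} {G : groupType} (X : set G) (p q : G -> R) c e :
  (cayley_dist X p q <= c%:E)%E -> 0 < e ->
  exists2 l, l < c + e & cayley_path X setT p q l.
Proof.
move=> dist_le e0; have : (cayley_dist X p q < (c + e)%:E)%E.
  by apply: le_lt_trans dist_le _; rewrite lte_fin ltrDl.
by case/ereal_inf_lt => _ [l pl <-]; rewrite lte_fin; exists l.
Qed.

Lemma cayley_path_trans {R : realType} {G : groupType} (X : set G) B (p q k : G -> R) l m :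
  cayley_path X B p q l -> cayley_path X B q k m -> cayley_path X B p k (l + m).
Proof.
elim=> [{}p _|g h s t {}q {}l gh s01 t01 inB _ IH]; first by rewrite add0r.
by rewrite -addrA => /IH; apply: cayley_path_cons.
Qed.

Lemma cayley_path_segment {R : realType} {G : groupType} (X : set G) (B : set (G -> R)) g h s t :
  cayley_adj X g h -> 0 <= s <= 1 -> 0 <= t <= 1 ->
  (forall r, 0 <= r <= 1 -> B (cayley_pt g h r)) ->
  cayley_path X B (cayley_pt g h s) (cayley_pt g h t) `|s - t|.
Proof.
move=> gh s01 t01 inB; rewrite -[`|_|]addr0; apply: cayley_path_cons => //.
  move=> r; rewrite ge_min le_max => rP; apply: inB.
  by case/andP: rP => /orP[] ? /orP[] ?; lra.
by apply: cayley_path_nil; apply: inB.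
Qed.

Lemma cayley_path_edge {R : realType} {G : groupType} (X : set G) (B : set (G -> R)) g h :
  cayley_adj X g h -> (forall r, 0 <= r <= 1 -> B (cayley_pt g h r)) ->
  cayley_path X B (cayley_vertex R g) (cayley_vertex R h) 1.
Proof.
move=> gh inB; rewrite -(@cayley_pt0 R G g h) -(@cayley_pt1 R G g h).
have := @cayley_path_segment R G X B g h 0 1 gh _ _ inB.
by rewrite sub0r normrN1; apply; rewrite lexx ler01.
Qed.

Lemma vpath_cayley {R : realType} (B : set (G11 -> R)) M n g h :
  vpath (Z.of_nat M) n (state_of g) (state_of h) ->
  (forall u v r, cayley_adj X11 u v -> (norm u <= M)%N -> 0 <= r <= 1 ->
     B (cayley_pt u v r)) ->
  B (cayley_vertex R h) ->
  cayley_path X11 B (cayley_vertex R g) (cayley_vertex R h) n%:R.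
Proof.
move Ex: (state_of g) => x; move Ey: (state_of h) => y p inB Bh.
elim: p g Ex Ey => [{}x _|{}x l {}n {}y xM _ IH] g Ex Ey.
  by move/state_of_inj: (etrans Ex (esym Ey)) => ->; apply: cayley_path_nil.
have adj : cayley_adj X11 g (g * cls [:: l])%g by apply/cayley_adjP; exists l.
rewrite -add1n natrD; apply: (cayley_path_trans (cayley_path_edge adj _)) (IH _ _ Ey).
  move=> r; apply: inB => //; move: xM; rewrite -Ex len_norm => xM.
  by apply/ssrnat.leP; lia.
by rewrite state_of_mul Ex.
Qed.

Lemma path_from1 {R : realType} g :
  cayley_path X11 setT (cayley_vertex R 1%g) (cayley_vertex R g) (norm g)%:R.
Proof. by apply: vpath_cayley => //; rewrite state_of1; apply: norm_vpath. Qed.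

Lemma vertex_in_ball {R : realType} g N : (norm g <= N)%N ->
  cayley_ball X11 N (cayley_vertex R g).
Proof.
move=> gN; apply: (@le_trans _ _ (norm g)%:R%:E); last by rewrite lee_fin ler_nat.
by apply: ereal_inf_lbound; exists (norm g)%:R => //; apply: path_from1.
Qed.

(** Only one endpoint has to be strictly inside the ball; the midpoint of an edge
with both endpoints on the sphere is outside. *)
Lemma edge_in_ball {R : realType} g h (r : R) N : cayley_adj X11 g h ->
  (norm g < N)%N -> 0 <= r <= 1 -> cayley_ball X11 N (cayley_pt g h r).
Proof.
move=> gh gN r01; apply: (@le_trans _ _ ((norm g)%:R + `|0 - r|)%:E).
  apply: ereal_inf_lbound; exists ((norm g)%:R + `|0 - r|) => //.
  apply: cayley_path_trans (path_from1 g) _; rewrite -(cayley_pt0 g h).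
  by apply: cayley_path_segment; rewrite ?lexx ?ler01.
rewrite lee_fin sub0r normrN ger0_norm; last by case/andP: r01.
have : (norm g).+1%:R <= N%:R :> R by rewrite ler_nat.
by rewrite -natr1; lra.
Qed.

Lemma cayley_point_le1 {R : realType} {G : groupType} (X : set G) (p : G -> R) u :
  cayley_point X p -> p u <= 1.
Proof.
have b01 (b : bool) : 0 <= (b%:R : R) <= 1 by case: b; rewrite ?lexx ?ler01.
case=> [[g ->]|[g [h [t [_ t01 ->]]]]]; first by have := b01 (u == g); case/andP.
rewrite /cayley_pt; have := b01 (u == g); have := b01 (u == h).
by move: (_%:R) (_%:R) => b c b01' c01'; nra.
Qed.

(** The path metric is an infimum, so the bound is first obtained up to any
positive error; as [p] has at most two endpoints, one of them works for all
errors. *)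
Lemma ball_reached {R : realType} N (p : G11 -> R) :
  cayley_point X11 p -> cayley_ball X11 N p ->
  reached (fun g => (norm g)%:R) p N%:R.
Proof.
move=> cp ballp; have near e : 0 < e ->
    exists2 u, 0 < p u & (norm u)%:R + (1 - p u) < N%:R + e.
  move=> e0; have [l lN path] := dist_path ballp e0.
  have lipn g h : cayley_adj X11 g h -> (norm g)%:R <= (norm h)%:R + 1 :> R.
    by move=> /norm_adj gh; rewrite natr1 ler_nat.
  have [|u pu ul] := reached_path lipn path (r := 0).
    by exists 1%g; rewrite /cayley_vertex eqxx mulr1n ?norm1 ?mulr0n; lra.
  by exists u => //; apply: le_lt_trans ul _; rewrite add0r.
apply: contrapT => far.
have pos u : exists2 e : R, 0 < e & 0 < p u -> N%:R + e <= (norm u)%:R + (1 - p u).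
  have [pu|pu] := ltP 0 (p u); last by exists 1 => //; lra.
  have [le|gt] := leP ((norm u)%:R + (1 - p u)) N%:R; first by case: far; exists u.
  by exists ((norm u)%:R + (1 - p u) - N%:R) => [|_]; lra.
have [g [h supp]] : exists g h, forall u, 0 < p u -> u = g \/ u = h.
  case: cp => [[g ->]|[g [h [t [_ _ ->]]]]]; last by exists g, h => u /cayley_pt_support.
  by exists g, g => u; rewrite /cayley_vertex; case: eqP => [->|]; [left|rewrite ltxx].
have [d d0 gd] := pos g; have [e e0 he] := pos h.
have [|u pu] := near (Num.min d e); first by rewrite lt_min d0.
rewrite ltNge => /negP; apply; case: (supp u pu) => Eu; rewrite Eu in pu *.
  by apply: le_trans (gd pu); rewrite lerD2l ge_min lexx.
by apply: le_trans (he pu); rewrite lerD2l ge_min lexx orbT.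
Qed.

(** If [p] is in the interior of an edge and in the ball, then one endpoint is
strictly inside the ball because lengths are integers; so the whole edge is in
the ball. *)
Lemma ball_endpoint {R : realType} N (p : G11 -> R) u :
  cayley_point X11 p -> cayley_ball X11 N p -> 0 < p u ->
  [/\ (norm u <= N)%N,
   exists2 l, l <= 1 & cayley_path X11 (cayley_ball X11 N) p (cayley_vertex R u) l &
   exists2 l, l <= 1 & cayley_path X11 (cayley_ball X11 N) (cayley_vertex R u) p l].
Proof.
move=> cp ballp pu; have [v pv vN] := ball_reached cp ballp.
have pv1 := cayley_point_le1 v cp.
have vertex_case g : p = cayley_vertex R g ->
    [/\ (norm u <= N)%N,
   exists2 l, l <= 1 & cayley_path X11 (cayley_ball X11 N) p (cayley_vertex R u) l &
   exists2 l, l <= 1 & cayley_path X11 (cayley_ball X11 N) (cayley_vertex R u) p l].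
  move=> Ep; have supp w : 0 < p w -> w = g.
    by rewrite Ep /cayley_vertex; case: eqP => // _; rewrite ltxx.
  rewrite (supp u pu) -Ep.
  have gN : (norm g)%:R <= N%:R :> R by have Ev := supp v pv; rewrite Ev in pv1 vN; lra.
  split; first by rewrite -(ler_nat R).
    by exists 0 => //; apply: cayley_path_nil.
  by exists 0 => //; apply: cayley_path_nil.
case: (cp) => [[g Eg]|[g [h [t [gh t01 Ep]]]]]; first exact: vertex_case Eg.
have [Egh|neq] := eqVneq g h.
  by apply: (vertex_case g); rewrite Ep -Egh cayley_pt_refl.
wlog Ev : g h t gh t01 Ep neq / v = g.
  move=> H; have := pv; rewrite {1}Ep => /cayley_pt_support[] Ev; first exact: (H g h t).
  apply: (H h g (1 - t)) => //; first exact: cayley_adj_sym.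
  - by lra.
  - by rewrite cayley_ptC subKr.
  - by rewrite eq_sym.
have [t0|tN0] := eqVneq t 0.
  by apply: (vertex_case g); rewrite Ep t0 cayley_pt0.
have gN : (norm g < N)%N.
  rewrite -(ltr_nat R); move: vN; rewrite Ev Ep cayley_pt_l //.
  have t_gt0 : 0 < t by rewrite lt_neqAle eq_sym tN0; case/andP: t01.
  by lra.
have inB (r : R) : 0 <= r <= 1 -> cayley_ball X11 N (cayley_pt g h r) by apply: edge_in_ball.
have hN : (norm h <= N)%N.
  by apply: leq_trans (norm_adj (cayley_adj_sym gh)) gN.
have seg (s s' : R) : 0 <= s <= 1 -> 0 <= s' <= 1 ->
    exists2 l, l <= 1 & cayley_path X11 (cayley_ball X11 N) (cayley_pt g h s)
      (cayley_pt g h s') l.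
  move=> s01 s01'; exists `|s - s'|; last exact: cayley_path_segment gh s01 s01' inB.
  by rewrite ler_norml; lra.
have z01 : 0 <= (0 : R) <= 1 by rewrite lexx ler01.
have o01 : 0 <= (1 : R) <= 1 by rewrite lexx ler01.
have := pu; rewrite {1}Ep => /cayley_pt_support[] ->; rewrite Ep.
  by rewrite -(cayley_pt0 g h); split; [exact: ltnW|exact: seg|exact: seg].
by rewrite -(cayley_pt1 g h); split; [|exact: seg|exact: seg].
Qed.

Lemma step_in_ball {R : realType} N g h w : (size w <= 1)%N ->
  h = (g * cls w)%g -> (norm h <= N)%N -> (norm g <= N.+1)%N ->
  exists2 l : R, l <= 1 &
    cayley_path X11 (cayley_ball X11 N.+1) (cayley_vertex R g) (cayley_vertex R h) l /\
    cayley_path X11 (cayley_ball X11 N.+1) (cayley_vertex R h) (cayley_vertex R g) l.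
Proof.
case: w => [|x []] // _ Eh hN gN.
  have -> : h = g by rewrite Eh [cls _](_ : _ = 1%g) ?mulg1.
  by exists 0 => //; split; apply: cayley_path_nil; apply: vertex_in_ball.
have adj : cayley_adj X11 g h by apply/cayley_adjP; exists x.
have inB (r : R) : 0 <= r <= 1 -> cayley_ball X11 N.+1 (cayley_pt h g r).
  by apply: edge_in_ball => //; apply: cayley_adj_sym.
exists 1 => //; split; last exact: cayley_path_edge (cayley_adj_sym adj) inB.
by apply: (cayley_path_edge adj) => r r01; rewrite cayley_ptC; apply: inB; lra.
Qed.

Theorem mainTheorem5 (R : realType) : almost_convex R X11.
Proof.
have [C HC] := vpath_word 4; exists (C%:R + 4) => N p q cp cq pq ballp ballq.
have [u pu u_half] : exists2 u, 0 < p u & 1 / 2 <= p u.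
  case: cp => [[g ->]|[g [h [t [_ t01 ->]]]]].
    by exists g; rewrite /cayley_vertex eqxx mulr1n; lra.
  have [Egh|neq] := eqVneq g h.
    by exists g; rewrite -Egh cayley_pt_refl /cayley_vertex eqxx mulr1n; lra.
  have [le|gt] := leP t (1 / 2).
    by exists g; rewrite cayley_pt_l //; lra.
  by exists h; rewrite cayley_ptC cayley_pt_l 1?eq_sym //; lra.
have [v qv uv2] : exists2 v, 0 < q v & (norm (u^-1 * v)%g <= 2)%N.
  have lipn g h : cayley_adj X11 g h ->
      (norm (u^-1 * g)%g)%:R <= (norm (u^-1 * h)%g)%:R + 1 :> R.
    by move=> gh; rewrite natr1 ler_nat; apply: norm_adj_transl.
  (* u is within 1/2 of p, so q is within 1/2 + 2 + 1/4 < 3 of u *)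
  have [l l2 path] := @dist_path R _ _ _ _ _ (1 / 4) pq ltac:(lra).
  have [|v qv vl] := reached_path lipn path (r := 1 / 2).
    by exists u => //; rewrite mulVg norm1; lra.
  exists v => //; rewrite -ltnS -(ltr_nat R).
  by have := cayley_point_le1 v cq; lra.
have [uN [l1 l1le p1] _] := ball_endpoint cp ballp pu.
have [vN _ [l2 l2le p2]] := ball_endpoint cq ballq qv.
(* the ball of radius 0 has no room for a step inwards, but it is a point *)
case: N => [|n] in ballp ballq uN vN p1 p2 *.
  have norm0 g : (norm g <= 0)%N -> g = 1%g.
    rewrite leqn0 => /eqP g0; have [w] := norm_word g.
    by rewrite g0 => /size0nil -> <-.
  exists (l1 + l2); first by have := ler0n R C; lra.
  by apply: cayley_path_trans p1 _; rewrite (norm0 u uN) -(norm0 v vN).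
have [u1 u1n [wu su Eu]] := @norm_pred u n uN.
have [v1 v1n [wv sv Ev]] := @norm_pred v n vN.
have [w sw Ew] := norm_word (u^-1 * v)%g.
have [l3 l3le [p3 _]] := step_in_ball (R := R) su Eu u1n uN.
have [l4 l4le [_ p4]] := step_in_ball (R := R) sv Ev v1n vN.
(* at most 1 + 2 + 1 letters lead from u1 to v1 *)
pose k := inv_word wu ++ w ++ wv.
have Ek : v1 = (u1 * cls k)%g.
  rewrite !cls_cat [cls (inv_word _)]presented_class_inv Ew Ev Eu.
  by rewrite !mulgA mulgK mulgV mul1g.
have sk : (size k <= 4)%N.
  rewrite !size_cat size_map size_rev sw.
  by apply: (leq_add su (leq_add uv2 sv)).
have [||m mC path] := HC (Z.of_nat n) (state_of u1) k (state_of_reduced u1) sk.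
- by rewrite len_norm; apply/inj_le/ssrnat.leP.
- by rewrite -state_of_mul -Ek len_norm; apply/inj_le/ssrnat.leP.
rewrite -state_of_mul -Ek in path.
have {}path : cayley_path X11 (cayley_ball X11 n.+1) (cayley_vertex R u1)
    (cayley_vertex R v1) m%:R.
  apply: vpath_cayley path _ _; last exact/vertex_in_ball/leqW.
  by move=> g h r gh gn; apply: edge_in_ball.
exists (l1 + (l3 + (m%:R + (l4 + l2)))).
  have : m%:R <= C%:R :> R by rewrite ler_nat.
  by lra.
exact: cayley_path_trans p1 (cayley_path_trans p3
  (cayley_path_trans path (cayley_path_trans p4 p2))).
Qed.
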